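(* Let $E$ be a real Banach lattice with order continuous norm. Let $\mathscr{T}=(T(t))_{t\in [0,\infty)}$ be a positive, irreducible and bounded strongly continuous semigroup on $E$ with generator $A$. If there exists $t_0>0$ such that $T(t_0)\geq K>0$, where $K:E\to E$ is a compact operator or a kernel operator, then $\sigma_p(A_{\mathbb{C}}) \cap i\mathbb{R} \subseteq \{ 0\}$.
   Context: Let $E$ be a real Banach lattice with order continuous norm. For operators, $T\ge K$ means $T-K$ is positive, and $K>0$ means $K$ is positive and $K\neq 0$. A strongly continuous semigroup is a family $(T(t))_{t\in[0,\infty)}$ of bounded linear operators on $E$ with $T(0)=I$, $T(t+s)=T(t)T(s)$ for all $t,s\geq 0$, and $t\mapsto T(t)x$ continuous for every $x\in E$. It is positive if every $T(t)$ is positive, and bounded if $\sup_{t}\|T(t)\|<\infty$. It is irreducible if the only closed (lattice) ideals $J\subseteq E$ with $T(t)J\subseteq J$ for all $t$ are $\{0\}$ and $E$. A linear operator on $E$ is regular if it is the difference of two positive operators; the regular operators on $E$ form an order complete vector lattice. $E'\otimes E$ denotes the space of finite rank operators on $E$. Kernel operators are the elements of $(E'\otimes E)^{\perp\perp}$, the band generated by $E'\otimes E$ in the lattice of regular operators. $E_{\mathbb{C}}$ denotes the complexification of $E$, and $A_{\mathbb{C}}$ the complexification of $A$, which is the generator of $(T(t)_{\mathbb{C}})_{t\ge0}$ on $E_{\mathbb{C}}$. $\sigma_p$ denotes the point spectrum (set of eigenvalues). *)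

(* Defs.v *)
From HB Require Import structures.
From mathcomp Require Import all_boot all_order all_algebra.
From mathcomp Require Import all_classical all_reals all_analysis.
From mathcomp Require Import complex.

Set Implicit Arguments.
Unset Strict Implicit.
Unset Printing Implicit Defensive.

Import Order.TTheory GRing.Theory Num.Theory.
Import numFieldNormedType.Exports.

Local Open Scope classical_set_scope.
Local Open Scope ring_scope.

(* The order is a field of the structure and not inherited from [porderType]:
   Hierarchy-Builder rejects a structure below [porderType] and [normedModType]
   that is not above [numDomainType].  Only binary suprema are postulated: the
   infimum of [x] and [y] is then [- riesz_sup (- x) (- y)]. *)
HB.mixin Record isRieszSpace (R : realType) E of GRing.Lmodule R E := {
  riesz_le : rel E ;
  riesz_le_refl : reflexive riesz_le ;
  riesz_le_anti : antisymmetric riesz_le ;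
  riesz_le_trans : transitive riesz_le ;
  riesz_leD2r : forall x y z : E, riesz_le x y -> riesz_le (x + z) (y + z) ;
  riesz_leZ : forall (a : R) (x y : E),
    0 <= a -> riesz_le x y -> riesz_le (a *: x) (a *: y) ;
  riesz_sup : E -> E -> E ;
  riesz_leUx : forall x y z : E,
    riesz_le (riesz_sup x y) z = riesz_le x z && riesz_le y z }.

#[short(type="rieszSpaceType")]
HB.structure Definition RieszSpace (R : realType) :=
  { E of GRing.Lmodule R E & isRieszSpace R E }.

Local Notation "x <=L y" := (riesz_le x y) (at level 70, y at next level).

Definition modulus (R : realType) (E : rieszSpaceType R) (x : E) : E :=
  riesz_sup x (- x).

HB.mixin Record isBanachLattice (R : realType) E
    of CompleteNormedModule R E & RieszSpace R E := {
  lattice_norm : forall x y : E, modulus x <=L modulus y -> `|x| <= `|y| }.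

#[short(type="banachLatticeType")]
HB.structure Definition BanachLattice (R : realType) :=
  { E of CompleteNormedModule R E & RieszSpace R E & isBanachLattice R E }.

Section BanachLattices.
Context {R : realType} {E : banachLatticeType R}.
Implicit Types (S T U V P Q K : {linear E -> E}).

(* A decreasing net with infimum [0] is taken as a downward directed set
   indexed by itself. *)
Definition downward_directed (D : set E) : Prop :=
  D !=set0 /\
  forall x y, D x -> D y -> exists z, [/\ D z, z <=L x & z <=L y].

Definition is_inf (D : set E) (a : E) : Prop :=
  (forall x, D x -> a <=L x) /\
  (forall b, (forall x, D x -> b <=L x) -> b <=L a).

Definition order_continuous_norm : Prop :=
  forall D : set E, downward_directed D -> is_inf D 0 ->
  forall e : R, 0 < e ->
    exists2 x0, D x0 & forall x, D x -> x <=L x0 -> `|x| < e.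

Definition lattice_ideal (J : set E) : Prop :=
  [/\ J 0,
      forall x y, J x -> J y -> J (x + y),
      forall (a : R) x, J x -> J (a *: x)
    & forall x y, J y -> modulus x <=L modulus y -> J x].

Definition op_le (S T : {linear E -> E}) : Prop :=
  forall x : E, 0 <=L x -> S x <=L T x.

Definition positive_op T : Prop := forall x : E, 0 <=L x -> 0 <=L T x.

Definition regular_op T : Prop :=
  exists P Q, [/\ positive_op P, positive_op Q & forall x, T x = P x - Q x].

Definition compact_op K : Prop := precompact (K @` [set x : E | `|x| <= 1]).

Definition finite_rank_op T : Prop :=
  exists (n : nat) (phi : 'I_n -> {linear E -> R^o}) (y : 'I_n -> E),
    (forall i, continuous (phi i)) /\
    forall x, T x = \sum_(i < n) (phi i x : R) *: y i.

(* Suprema and infima are taken within the ordered space of regular operators,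
   not among all linear operators. *)
Definition regular_sup S T U : Prop :=
  [/\ regular_op U, op_le S U, op_le T U
    & forall V, regular_op V -> op_le S V -> op_le T V -> op_le U V].

Definition regular_inf S T U : Prop :=
  [/\ regular_op U, op_le U S, op_le U T
    & forall V, regular_op V -> op_le V S -> op_le V T -> op_le V U].

Definition regular_modulus S U : Prop := regular_sup S (\- S) U.

(* |S| /\ |T| = 0; all these bounds exist when [E] is order complete, hence when
   its norm is order continuous. *)
Definition disjoint_op S T : Prop :=
  exists U V, [/\ regular_modulus S U, regular_modulus T V
                & regular_inf U V \0].

Definition disjoint_compl (A : set {linear E -> E}) : set {linear E -> E} :=
  [set S | regular_op S /\ forall T, A T -> disjoint_op S T].

Definition kernel_op K : Prop :=
  disjoint_compl (disjoint_compl [set T | finite_rank_op T]) K.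

(* Only the values of [T] at times [t >= 0] are meaningful. *)
Definition C0_semigroup (T : R -> {linear E -> E}) : Prop :=
  [/\ forall t, 0 <= t -> continuous (T t),
      forall x, T 0 x = x,
      forall t s, 0 <= t -> 0 <= s -> forall x, T (t + s) x = T t (T s x)
    & forall x, {within [set t : R | 0 <= t], continuous (fun t => T t x)}].

Definition positive_semigroup (T : R -> {linear E -> E}) : Prop :=
  forall t, 0 <= t -> positive_op (T t).

Definition bounded_semigroup (T : R -> {linear E -> E}) : Prop :=
  exists M : R, forall t, 0 <= t -> forall x, `|T t x| <= M * `|x|.

Definition irreducible_semigroup (T : R -> {linear E -> E}) : Prop :=
  forall J : set E, lattice_ideal J -> closed J ->
    (forall t, 0 <= t -> T t @` J `<=` J) -> J = [set 0] \/ J = setT.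

(* The generator [A] as a graph: [generator T x y] means that [x] is in the
   domain of [A] and [A x = y]. *)
Definition generator (T : R -> {linear E -> E}) (x y : E) : Prop :=
  (fun h : R => h^-1 *: (T h x - x)) @ 0^'+ --> y.

End BanachLattices.
Arguments order_continuous_norm {R} E.

(* The pair [(x, y)] stands for x + i y. *)
Definition complexification (R : realType) (E : lmodType R) : Type :=
  (E * E)%type.

Section Complexification.
Context {R : realType} {E : lmodType R}.
Local Notation EC := (complexification E).

HB.instance Definition _ := GRing.Zmodule.copy EC (E * E)%type.

Definition scale_complexification (c : R[i]) (z : EC) : EC :=
  (complex.Re c *: z.1 - complex.Im c *: z.2,
   complex.Re c *: z.2 + complex.Im c *: z.1).

Lemma scale_complexificationA (a b : R[i]) (z : EC) :
  scale_complexification a (scale_complexification b z) =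
  scale_complexification (a * b) z.
Proof.
case: a b z => [a1 a2] [b1 b2] [x y]; rewrite /scale_complexification /=.
by congr pair; rewrite !(scalerBr, scalerDr) !scalerA !(scalerBl, scalerDl) ?opprD;
  rewrite [RHS](AC (2*2) ((1*3)*(4*2))).
Qed.

Lemma scale1_complexification (z : EC) : scale_complexification 1 z = z.
Proof.
by case: z => x y; rewrite /scale_complexification /= !scale1r !scale0r subr0 addr0.
Qed.

Lemma scale_complexificationDr (a : R[i]) (z w : EC) :
  scale_complexification a (z + w) =
  scale_complexification a z + scale_complexification a w.
Proof.
case: a z w => [a1 a2] [x y] [u v]; rewrite /scale_complexification /=.
by congr pair; rewrite /= !scalerDr ?opprD addrACA.
Qed.

Lemma scale_complexificationDl (z : EC) (a b : R[i]) :
  scale_complexification (a + b) z =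
  scale_complexification a z + scale_complexification b z.
Proof.
case: a b z => [a1 a2] [b1 b2] [x y]; rewrite /scale_complexification /=.
by congr pair; rewrite /= !scalerDl ?opprD addrACA.
Qed.

HB.instance Definition _ := GRing.Zmodule_isLmodule.Build R[i] EC
  scale_complexificationA scale1_complexification
  scale_complexificationDr (fun z a b => scale_complexificationDl z a b).

(* Graph of [A_C], with domain D(A) + i D(A), from the graph of [A]. *)
Definition complexify_graph (A : E -> E -> Prop) (z w : EC) : Prop :=
  A z.1 w.1 /\ A z.2 w.2.

End Complexification.

Definition point_spectrum (K : fieldType) (V : lmodType K)
    (A : V -> V -> Prop) : set K :=
  [set lambda | exists2 z : V, z <> 0 & A z (lambda *: z)].

Definition imaginary_axis (R : realType) : set R[i] :=
  [set lambda | complex.Re lambda = 0].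
Arguments imaginary_axis : clear implicits.

(* Main.v *)
Require Import Defs.
From HB Require Import structures.
From mathcomp Require Import all_boot all_order all_algebra.
From mathcomp Require Import all_classical all_reals all_analysis.
From mathcomp Require Import complex ring lra.

Import Order.TTheory GRing.Theory Num.Theory.
Import numFieldNormedType.Exports.

Local Open Scope classical_set_scope.
Local Open Scope ring_scope.

(** Suppose that [a + i b] is an eigenvector for [i w] with [w <> 0].  The semigroup
then rotates the pair [(a, b)] ([eigenvector_orbit]), and after a change of the unit
of time it is a semigroup [P] with [P 1 a = - a].  In a space of functions one would
write [a + i b = y * exp (i theta)] with a fixed [y], and [P t] would translate the
angle [theta] by [pi t].  Two ideas lead to a contradiction with the operator [K]
below [P t0].

The first one is to construct Rademacher functions of [theta] without functions.
The role of a strictly positive invariant functional is played by the seminorm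
[mean_norm], the upper limit of the norms of the Cesaro means of [modulus x].  By
irreducibility it vanishes only at zero ([mean_norm_eq0]); so a positive vector that
the semigroup increases is fixed, and on the vectors of period 2 the semigroup acts
by lattice isomorphisms ([periodic_modulus]).  The supremum of the moduli of the orbit
of [a] is therefore a fixed vector [y] ([orbit_modulus]).  The sign [r 0] of [a]
relative to [y] satisfies [P 1 (r 0) = - r 0] ([first_rademacher]), and if [q] is the
translate of [r] by half its antiperiod, the product of the signs [r] and [q], which
is [(|r + q| - |r - q|) / 2] in lattice terms, has half the antiperiod of [r]
([next_rademacher]).  This gives [r k] with modulus [y] that changes sign under
[P (2 ^ - k)], while the later [r l] do not change.  Hence the [r k] behave like
independent signs: replacing them one by one by random multiples of [y] shows that
a signed sum of [n] of them has a seminorm of order [sqrt n]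
([rademacher_sum_bound]).

The second idea is that an operator [0 <= K <= P t0] is a lattice homomorphism on
the vectors of period 2 ([dominated_modulus]), so that [modulus (K (r k)) = K y],
and [K y <> 0] by irreducibility ([dominated_fixed_eq0]).  If [K] is compact, the
sequence [K (r k)] has a cluster point.  It is close to averages of the [K (r k)],
which tend to zero, so it is zero, and [K y = 0] ([compact_dominated_eq0]).  If [K]
is a kernel operator, it majorizes some [Q > 0] with [Q x <= |x| u] for a fixed [u]
([kernel_op_minorant]).  The supremum over all signs of [Q (sum of +- r k)], with
[n] terms, is [n Q y]; on the other hand it is at most [o(n) u], because the norm is
controlled by the seminorm on order intervals ([norm_dominated_eq0],
[mean_norm_absolutely_continuous]).  Hence [Q y = 0]. *)

Set Implicit Arguments.
Unset Strict Implicit.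
Unset Printing Implicit Defensive.

Local Notation "x <=L y" := (riesz_le x y) (at level 70, y at next level).

(** * Linear identities in modules *)

Section ModuleExpressions.
Context {R : comNzRingType} {V : lmodType R}.

(** Syntax for the expressions that the tactic below decides by comparing the
coefficients of their atoms. *)
Inductive module_expr :=
  | MVar of nat | MZero | MAdd of module_expr & module_expr
  | MOpp of module_expr | MScale of R & module_expr
  | MMuln of module_expr & nat.

Fixpoint module_eval (env : seq V) e : V := match e with
  | MVar n => nth 0 env n
  | MZero => 0
  | MAdd e1 e2 => module_eval env e1 + module_eval env e2
  | MOpp e1 => - module_eval env e1
  | MScale c e1 => c *: module_eval env e1
  | MMuln e1 n => module_eval env e1 *+ n
  end.

Fixpoint module_coef e (i : nat) : R := match e with
  | MVar n => if n == i then 1 else 0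
  | MZero => 0
  | MAdd e1 e2 => module_coef e1 i + module_coef e2 i
  | MOpp e1 => - module_coef e1 i
  | MScale c e1 => c * module_coef e1 i
  | MMuln e1 n => module_coef e1 i * n%:R
  end.

Fixpoint same_coefs e1 e2 n : Prop := match n with
  | 0 => True
  | n.+1 => module_coef e1 n = module_coef e2 n /\ same_coefs e1 e2 n
  end.

Lemma module_evalE env e :
  module_eval env e = \sum_(i < size env) module_coef e i *: nth 0 env i.
Proof.
elim: e => [n||e1 IH1 e2 IH2|e IH|c e IH|e IH n] /=.
- case: (ltnP n (size env)) => hn.
    rewrite (bigD1 (Ordinal hn)) //= eqxx scale1r big1 ?addr0 // => i hi.
    by rewrite ifN ?scale0r // eq_sym; apply: contraNneq hi => h; apply/eqP/val_inj.
  rewrite nth_default // big1 // => i _.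
  by rewrite ifN ?scale0r // gtn_eqF // (leq_trans (ltn_ord i)).
- by rewrite big1 // => i _; rewrite scale0r.
- by rewrite IH1 IH2 -big_split; apply: eq_bigr => i _; rewrite scalerDl.
- by rewrite IH -sumrN; apply: eq_bigr => i _; rewrite scaleNr.
- by rewrite IH scaler_sumr; apply: eq_bigr => i _; rewrite scalerA.
- rewrite IH -sumrMnl; apply: eq_bigr => i _.
  by rewrite mulrC -scalerA scaler_nat.
Qed.

Lemma module_eval_eq env e1 e2 :
  same_coefs e1 e2 (size env) -> module_eval env e1 = module_eval env e2.
Proof.
rewrite !module_evalE => h; apply: eq_bigr => i _; congr (_ *: _).
move: (size env) h i => n; elim: n => [|n IH] /= => [_ []//|[h1 h2] i].
by case: (ltngtP i n) => [hi|hi|-> //]; [exact: (IH h2 (Ordinal hi))|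
  have := ltn_ord i; rewrite ltnS leqNgt hi].
Qed.
End ModuleExpressions.

(* Atoms are compared up to unification, because equal terms may carry different
   paths to the same canonical structure. *)
Ltac module_index x env :=
  match env with
  | ?h :: _ => let _ := match goal with _ => unify h x end in constr:(0%N)
  | _ :: ?t => let n := module_index x t in constr:(S n)
  end.
Ltac module_mem x env :=
  match env with
  | ?h :: _ => let _ := match goal with _ => unify h x end in constr:(true)
  | _ :: ?t => module_mem x t
  | _ => constr:(false)
  end.
Ltac module_atoms env e :=
  lazymatch e with
  | @GRing.add _ ?x ?y => let env1 := module_atoms env x in module_atoms env1 y
  | @GRing.opp _ ?x => module_atoms env x
  | @GRing.scale _ _ _ ?x => module_atoms env x
  | @GRing.natmul _ ?x _ => module_atoms env x
  | @GRing.zero _ => env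
  | _ => let b := module_mem e env in
         lazymatch b with true => env | _ => constr:(e :: env) end
  end.
Ltac module_reify R env e :=
  lazymatch e with
  | @GRing.add _ ?x ?y =>
      let a := module_reify R env x in let b := module_reify R env y in
      constr:(@MAdd R a b)
  | @GRing.opp _ ?x => let a := module_reify R env x in constr:(@MOpp R a)
  | @GRing.scale _ _ ?c ?x =>
      let a := module_reify R env x in constr:(@MScale R c a)
  | @GRing.natmul _ ?x ?n =>
      let a := module_reify R env x in constr:(@MMuln R a n)
  | @GRing.zero _ => constr:(@MZero R)
  | _ => let n := module_index e env in constr:(@MVar R n)
  end.
Ltac module_identity :=
  lazymatch goal with
  | [ R : realType |- @eq ?V ?x ?y ] =>
      let env0 := module_atoms (@nil V) x in
      let env := module_atoms env0 y in
      let a := module_reify R env x in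
      let b := module_reify R env y in
      apply: (@module_eval_eq R _ env a b);
      rewrite /=; repeat split; try ring; try lra
  end.

(** * Identities in vector lattices *)

Section RieszSpaces.
Context {R : realType} {E : rieszSpaceType R}.
Implicit Types (x y z u v w : E) (a c : R).

Lemma rle_refl x : x <=L x. Proof. exact: riesz_le_refl. Qed.
Hint Resolve rle_refl : core.
Lemma rle_trans y x z : x <=L y -> y <=L z -> x <=L z.
Proof. exact: riesz_le_trans. Qed.
Lemma rle_anti x y : x <=L y -> y <=L x -> x = y.
Proof. by move=> h1 h2; apply: (@riesz_le_anti _ E); rewrite h1 h2. Qed.

(** The workhorse for linear inequalities: the certificate is one linear identity. *)
Lemma rle_shift x y u v : x <=L y -> v - u = y - x -> u <=L v.
Proof.
move=> h e; have := riesz_leD2r x y (u - x) h.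
have -> : x + (u - x) = u by module_identity.
suff -> : y + (u - x) = v by [].
have -> : v = (v - u) + u by module_identity.
by rewrite e; module_identity.
Qed.

Lemma rleD x y u v : x <=L y -> u <=L v -> x + u <=L y + v.
Proof.
move=> h1 h2; apply: (rle_trans (y := y + u)).
  by apply: (rle_shift h1); module_identity.
by apply: (rle_shift h2); module_identity.
Qed.

Lemma rleN x y : x <=L y -> - y <=L - x.
Proof. by move=> h; apply: (rle_shift h); module_identity. Qed.

Lemma rsub_ge0 x y : 0 <=L y - x <-> x <=L y.
Proof. by split=> h; apply: (rle_shift h); module_identity. Qed.

Lemma rleZ a x y : 0 <= a -> x <=L y -> a *: x <=L a *: y.
Proof. exact: riesz_leZ. Qed.

Lemma raddr_ge0 x y : 0 <=L x -> 0 <=L y -> 0 <=L x + y.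
Proof. by move=> h1 h2; apply: (rle_shift (rleD h1 h2)); module_identity. Qed.

Lemma rscale_ge0 a x : 0 <= a -> 0 <=L x -> 0 <=L a *: x.
Proof. by move=> ha /(rleZ ha); rewrite scaler0. Qed.

Lemma rscale_le a c x : 0 <=L x -> a <= c -> a *: x <=L c *: x.
Proof.
move=> hx; rewrite -subr_ge0 => /rscale_ge0 /(_ hx) h.
by apply: (rle_shift h); module_identity.
Qed.

Lemma rlesup_l x y : x <=L riesz_sup x y.
Proof. by have := riesz_leUx x y (riesz_sup x y); rewrite rle_refl => /esym/andP[]. Qed.
Lemma rlesup_r x y : y <=L riesz_sup x y.
Proof. by have := riesz_leUx x y (riesz_sup x y); rewrite rle_refl => /esym/andP[]. Qed.
Lemma rsup_le x y z : x <=L z -> y <=L z -> riesz_sup x y <=L z.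
Proof. by move=> h1 h2; rewrite riesz_leUx h1 h2. Qed.

Definition riesz_inf x y : E := - riesz_sup (- x) (- y).

Lemma rinf_le_l x y : riesz_inf x y <=L x.
Proof. by have /rleN := rlesup_l (- x) (- y); rewrite opprK. Qed.
Lemma rinf_le_r x y : riesz_inf x y <=L y.
Proof. by have /rleN := rlesup_r (- x) (- y); rewrite opprK. Qed.
Lemma rle_inf x y z : z <=L x -> z <=L y -> z <=L riesz_inf x y.
Proof. by move=> /rleN h1 /rleN h2; rewrite -[z]opprK; apply/rleN/rsup_le. Qed.

Lemma rsup_shift x y z : riesz_sup (x + z) (y + z) = riesz_sup x y + z.
Proof.
apply: rle_anti.
  by apply: rsup_le; apply: rleD => //; [exact: rlesup_l|exact: rlesup_r].
have h : riesz_sup x y <=L riesz_sup (x + z) (y + z) - z.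
  by apply: rsup_le; [apply: (rle_shift (rlesup_l (x + z) (y + z)))|
    apply: (rle_shift (rlesup_r (x + z) (y + z)))]; module_identity.
by apply: (rle_shift h); module_identity.
Qed.

(** The reflection [z |-> x + y - z] exchanges [x] and [y], and reverses the order. *)
Lemma rsup_add_inf x y : riesz_sup x y + riesz_inf x y = x + y.
Proof.
have := rsup_shift (- y) (- x) (x + y).
have -> : - y + (x + y) = x by module_identity.
have -> : - x + (x + y) = y by module_identity.
move=> ->; rewrite /riesz_inf.
suff -> : riesz_sup (- y) (- x) = riesz_sup (- x) (- y) by module_identity.
by apply: rle_anti; apply: rsup_le; rewrite ?rlesup_l ?rlesup_r.
Qed.

Lemma rinf_shift x y z : riesz_inf (x + z) (y + z) = riesz_inf x y + z.
Proof.
rewrite /riesz_inf !opprD rsup_shift; module_identity.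
Qed.

Lemma rinfC x y : riesz_inf x y = riesz_inf y x.
Proof. by apply: rle_anti; apply: rle_inf; rewrite ?rinf_le_l ?rinf_le_r. Qed.

Lemma rinf_mono x y u v : x <=L u -> y <=L v -> riesz_inf x y <=L riesz_inf u v.
Proof.
by move=> h1 h2; apply: rle_inf; [exact: rle_trans (rinf_le_l _ _) h1|
  exact: rle_trans (rinf_le_r _ _) h2].
Qed.

(** The nontrivial half of distributivity.  It follows from [rsup_add_inf], which
expresses infima through suprema. *)
Lemma rinf_sup_le x y z :
  riesz_inf (riesz_sup x y) z <=L riesz_sup (riesz_inf x z) (riesz_inf y z).
Proof.
set s := riesz_sup x y; set m := riesz_sup (riesz_inf x z) _.
have hx : x + z <=L m + riesz_sup s z.
  rewrite -rsup_add_inf addrC; apply: rleD; first exact: rlesup_l.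
  by apply: rsup_le; [apply: (rle_trans (rlesup_l x y)); exact: rlesup_l|exact: rlesup_r].
have hy : y + z <=L m + riesz_sup s z.
  rewrite -rsup_add_inf addrC; apply: rleD; first exact: rlesup_r.
  by apply: rsup_le; [apply: (rle_trans (rlesup_r x y)); exact: rlesup_l|exact: rlesup_r].
have h : s + z <=L m + riesz_sup s z by rewrite -rsup_shift; apply: rsup_le.
move: h; rewrite -rsup_add_inf => h; apply: (rle_shift h); module_identity.
Qed.

Lemma rinf_addr x u v : 0 <=L x -> 0 <=L u -> 0 <=L v ->
  riesz_inf x (u + v) <=L riesz_inf x u + riesz_inf x v.
Proof.
move=> hx hu hv.
have := rinf_shift x v (riesz_inf x u).
rewrite [_ + riesz_inf x u in X in _ = X]addrC => <-.
set w := riesz_inf x (u + v).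
have wx : w <=L x by exact: rinf_le_l.
have wuv : w <=L u + v by exact: rinf_le_r.
have hi : 0 <=L riesz_inf x u by exact: rle_inf.
apply: rle_inf.
  by apply: (rle_trans wx); apply: (rle_shift hi); module_identity.
have : riesz_inf (x + v) (u + v) <=L v + riesz_inf x u.
  by rewrite rinf_shift addrC.
apply: rle_trans; apply: rle_inf => //.
by apply: (rle_trans wx); apply: (rle_shift hv); module_identity.
Qed.

Lemma rle_modulus x : x <=L modulus x. Proof. exact: rlesup_l. Qed.
Lemma rleN_modulus x : - x <=L modulus x. Proof. exact: rlesup_r. Qed.
Lemma modulus_le x y : x <=L y -> - x <=L y -> modulus x <=L y.
Proof. exact: rsup_le. Qed.

Lemma modulus_ge0 x : 0 <=L modulus x.
Proof.
have /(@rleZ 2^-1) := rleD (rle_modulus x) (rleN_modulus x).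
rewrite subrr scaler0 => /(_ _)/rle_trans; apply; first by rewrite invr_ge0.
suff -> : 2^-1 *: (modulus x + modulus x) = modulus x by [].
by module_identity.
Qed.
Hint Resolve modulus_ge0 : core.

Lemma modulusN x : modulus (- x) = modulus x.
Proof.
by apply: rle_anti; apply: modulus_le; rewrite ?opprK ?rle_modulus ?rleN_modulus //;
  rewrite -{1}[x]opprK ?rle_modulus ?rleN_modulus.
Qed.

Lemma ger0_modulus x : 0 <=L x -> modulus x = x.
Proof.
move=> h; apply: rle_anti; last exact: rle_modulus.
apply: modulus_le => //; apply: (rle_trans (y := 0)) => //.
by apply: (rle_shift h); module_identity.
Qed.

Lemma modulus_id x : modulus (modulus x) = modulus x.
Proof. exact: ger0_modulus. Qed.

Lemma modulus0 : modulus (0 : E) = 0.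
Proof. exact: ger0_modulus. Qed.

Lemma modulus_eq0 x : modulus x = 0 -> x = 0.
Proof.
move=> h; apply: rle_anti; first by rewrite -h; exact: rle_modulus.
by have := rleN_modulus x; rewrite h => h'; apply: (rle_shift h'); module_identity.
Qed.

Lemma modulusD x y : modulus (x + y) <=L modulus x + modulus y.
Proof.
apply: modulus_le; first by apply: rleD; exact: rle_modulus.
by rewrite opprD; apply: rleD; exact: rleN_modulus.
Qed.

Lemma modulusB x y : modulus (x - y) <=L modulus x + modulus y.
Proof. by have := modulusD x (- y); rewrite modulusN. Qed.

Lemma modulusZ a x : modulus (a *: x) = `|a| *: modulus x.
Proof.
suff pos c y : 0 < c -> modulus (c *: y) = c *: modulus y.
  case: (ltgtP a 0) => [a0|a0|->]; last by rewrite normr0 !scale0r modulus0.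
    rewrite ltr0_norm // -pos ?oppr_gt0 //.
    by rewrite -[LHS]modulusN; congr modulus; module_identity.
  by rewrite gtr0_norm // pos.
have le d z : 0 <= d -> modulus (d *: z) <=L d *: modulus z.
  move=> hd; apply: modulus_le; first by apply: rleZ => //; exact: rle_modulus.
  by rewrite -scalerN; apply: rleZ => //; exact: rleN_modulus.
move=> hc; apply: rle_anti; first exact/le/ltW.
have hc' : 0 <= c^-1 by rewrite invr_ge0 ltW.
have := rleZ (ltW hc) (le c^-1 (c *: y) hc').
by rewrite !scalerA mulVf ?mulfV ?gt_eqF // !scale1r.
Qed.

Lemma modulus_dist x y : modulus (modulus x - modulus y) <=L modulus (x - y).
Proof.
have h u v : modulus u - modulus v <=L modulus (u - v).
  have := modulusD (u - v) v; rewrite subrK => h.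
  by apply: (rle_shift h); module_identity.
apply: modulus_le; first exact: h.
by rewrite opprB -[X in _ <=L X]modulusN opprB; exact: h.
Qed.

(** A sum of two moduli is the supremum of four signed sums. *)
Lemma modulus_add_le u v z :
  u + v <=L z -> u - v <=L z -> - u + v <=L z -> - u - v <=L z ->
  modulus u + modulus v <=L z.
Proof.
move=> h1 h2 h3 h4.
have hu : modulus u <=L z - modulus v.
  have g w : w + v <=L z -> w - v <=L z -> w <=L z - modulus v.
    move=> e1 e2; suff : modulus v <=L z - w.
      by move=> h; apply: (rle_shift h); module_identity.
    by apply: modulus_le; [apply: (rle_shift e1)|apply: (rle_shift e2)]; module_identity.
  by apply: modulus_le; apply: g.
by apply: (rle_shift hu); module_identity.
Qed.

(** In the scalar case both sides are twice the larger of the two absolute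
values, which grows with the modulus of the perturbation. *)
Lemma modulus_symmetric_mono x r y : modulus r <=L y ->
  modulus (x + r) + modulus (x - r) <=L modulus (x + y) + modulus (x - y).
Proof.
move=> hr; have hy : modulus r <=L modulus y.
  exact: rle_trans hr (rle_modulus _).
have p1 := rle_modulus (x + y); have p2 := rle_modulus (x - y).
have n1 := rleN_modulus (x + y); have n2 := rleN_modulus (x - y).
have r1 := rle_trans (rle_modulus r) hr; have r2 := rle_trans (rleN_modulus r) hr.
apply: modulus_add_le.
- by apply: (rle_trans _ (rleD p1 p2)); apply: (rle_shift (rle_refl 0)); module_identity.
- apply: (rle_trans _ (rleD p1 n2)).
  by apply: (rle_shift (rleD r1 r1)); module_identity.
- apply: (rle_trans _ (rleD p1 n2)).
  by apply: (rle_shift (rleD r2 r2)); module_identity.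
- by apply: (rle_trans _ (rleD n1 n2)); apply: (rle_shift (rle_refl 0)); module_identity.
Qed.

Lemma modulus_sub_inf u v : 0 <=L u -> 0 <=L v -> riesz_inf u v = 0 ->
  modulus (u - v) = u + v.
Proof.
move=> hu hv h; have s : riesz_sup u v = u + v.
  by rewrite -rsup_add_inf h addr0.
apply: rle_anti.
  apply: modulus_le.
    by apply: (rle_shift (raddr_ge0 hv hv)); module_identity.
  by apply: (rle_shift (raddr_ge0 hu hu)); module_identity.
have h1 : u <=L 2^-1 *: (u + v + modulus (u - v)).
  apply: (rle_shift (rleZ (a := 2^-1) _ (rle_modulus (u - v)))); first by rewrite invr_ge0.
  by module_identity.
have h2 : v <=L 2^-1 *: (u + v + modulus (u - v)).
  apply: (rle_shift (rleZ (a := 2^-1) _ (rleN_modulus (u - v)))); first by rewrite invr_ge0.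
  by module_identity.
have := rsup_le h1 h2; rewrite s => h3.
by apply: (rle_shift (rleD h3 h3)); module_identity.
Qed.

Lemma riesz_infE x y : riesz_inf x y = 2^-1 *: (x + y - modulus (x - y)).
Proof.
rewrite /riesz_inf; have := rsup_shift (- x) (- y) (2^-1 *: (x + y)).
have h2 : 0 <= (2^-1 : R) by rewrite invr_ge0.
have -> : - x + 2^-1 *: (x + y) = - (2^-1 *: (x - y)) by module_identity.
have -> : - y + 2^-1 *: (x + y) = - (- (2^-1 *: (x - y))) by module_identity.
have -> : riesz_sup (- (2^-1 *: (x - y))) (- (- (2^-1 *: (x - y)))) =
  2^-1 *: modulus (x - y).
  by rewrite -/(modulus _) modulusN modulusZ ger0_norm.
set s := riesz_sup _ _ => h.
have -> : s = 2^-1 *: modulus (x - y) - 2^-1 *: (x + y) by rewrite h; module_identity.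
by module_identity.
Qed.

(** In the scalar case the infimum is [| |r| - |s| |]; here it is a supremum, by
distributivity, of terms such as [r - |s|]. *)
Lemma inf_modulus_addsub_eq0 r s : modulus r = modulus s ->
  riesz_inf (modulus (r + s)) (modulus (r - s)) = 0.
Proof.
move=> h; apply: rle_anti; last exact: rle_inf.
have key u v : modulus u = modulus v -> riesz_inf (u + v) (modulus (u - v)) <=L 0.
  move=> huv; rewrite rinfC; apply: (rle_trans (rinf_sup_le _ _ _)).
  have g p q : modulus p = modulus q -> riesz_inf (p - q) (p + q) <=L 0.
    move=> e; suff : riesz_inf (p - q) (p + q) <=L p - modulus p.
      rewrite e; have := rle_modulus p; rewrite e => h1 h2.
      by apply: (rle_trans h2); apply: (rle_shift h1); module_identity.
    have : modulus q <=L p - riesz_inf (p - q) (p + q).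
      apply: modulus_le; [apply: (rle_shift (rinf_le_l (p - q) (p + q)))|
        apply: (rle_shift (rinf_le_r (p - q) (p + q)))]; module_identity.
    by rewrite -e => h1; apply: (rle_shift h1); module_identity.
  apply: rsup_le; first exact: g.
  by rewrite opprB [u + v]addrC; apply: g; rewrite huv.
apply: (rle_trans (rinf_sup_le _ _ _)); apply: rsup_le; first exact: key.
have := key (- r) (- s); rewrite !modulusN opprK -opprD.
have -> : modulus (- r + s) = modulus (r - s).
  by rewrite -[LHS]modulusN; congr modulus; module_identity.
exact.
Qed.

(** For scalars and [y = 1], the outer modulus is that of the product [r s]: this is
the substitute for a product that turns Rademacher-like elements of period [t]
into elements of period [t / 2]. *)
Lemma modulus_signed_product r s y : modulus r = y -> modulus s = y ->
  modulus (2^-1 *: (modulus (r + s) - modulus (r - s))) = y.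
Proof.
move=> hr hs; rewrite modulusZ ger0_norm ?invr_ge0 //.
rewrite modulus_sub_inf //; last by rewrite inf_modulus_addsub_eq0 // hr hs.
suff -> : modulus (r + s) + modulus (r - s) = y + y by module_identity.
apply: rle_anti.
  have p1 : r <=L y by rewrite -hr; exact: rle_modulus.
  have p2 : s <=L y by rewrite -hs; exact: rle_modulus.
  have n1 : - r <=L y by rewrite -hr; exact: rleN_modulus.
  have n2 : - s <=L y by rewrite -hs; exact: rleN_modulus.
  by apply: modulus_add_le; [apply: (rle_shift (rleD p1 p1))|
    apply: (rle_shift (rleD p2 p2))|apply: (rle_shift (rleD n2 n2))|
    apply: (rle_shift (rleD n1 n1))]; module_identity.
have p := modulusD (r + s) (r - s).
move: p; have -> : r + s + (r - s) = 2 *: r by module_identity.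
by rewrite modulusZ ger0_norm // hr => h; apply: (rle_shift h); module_identity.
Qed.

Definition pospart x := riesz_sup x 0.

Lemma pospart_ge0 x : 0 <=L pospart x. Proof. exact: rlesup_r. Qed.
Hint Resolve pospart_ge0 : core.

Lemma pospart_sub x : pospart x - pospart (- x) = x.
Proof.
have := rsup_shift (- x) 0 x; rewrite addNr add0r -/(pospart (- x)).
rewrite /pospart => e; have -> : riesz_sup x 0 = riesz_sup 0 x.
  by apply: rle_anti; apply: rsup_le; rewrite ?rlesup_l ?rlesup_r.
by rewrite e; module_identity.
Qed.

Lemma pospartE x : pospart x = 2^-1 *: (modulus x + x).
Proof.
have h2 : 0 <= (2^-1 : R) by rewrite invr_ge0.
apply: rle_anti.
  apply: rsup_le.
    by apply: (rle_shift (rleZ h2 (rle_modulus x))); module_identity.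
  by apply: (rle_shift (rleZ h2 (rleN_modulus x))); module_identity.
have : modulus x <=L 2 *: pospart x - x.
  apply: modulus_le.
    by apply: (rle_shift (rleZ (a := 2) _ (rlesup_l x 0))) => //; module_identity.
  by apply: (rle_shift (rleZ (a := 2) _ (rlesup_r x 0))) => //; module_identity.
move=> h; apply: (rle_shift (rleZ h2 h)); module_identity.
Qed.

Lemma pospart_add x : pospart x + pospart (- x) = modulus x.
Proof. by rewrite !pospartE modulusN; module_identity. Qed.

Lemma pospart_inf x : riesz_inf (pospart x) (pospart (- x)) = 0.
Proof.
rewrite riesz_infE pospart_sub pospart_add; module_identity.
Qed.

Definition is_lub (D : set E) s :=
  (forall x, D x -> x <=L s) /\ forall b, (forall x, D x -> x <=L b) -> s <=L b.

(** If [x] is disjoint from [z], then [x + z] is the supremum of both; so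
[riesz_sup s z - z] is an upper bound of [D]. *)
Lemma inf_lub_eq0 (D : set E) s z : is_lub D s -> D !=set0 ->
  (forall x, D x -> 0 <=L x) -> 0 <=L z ->
  (forall x, D x -> riesz_inf x z = 0) -> riesz_inf s z = 0.
Proof.
move=> [s1 s2] [x0 Dx0] D0 z0 Dz; apply: rle_anti; last first.
  by apply: rle_inf => //; exact: rle_trans (D0 _ Dx0) (s1 _ Dx0).
have : s <=L riesz_sup s z - z.
  apply: s2 => x Dx; have e : riesz_sup x z = x + z.
    by rewrite -rsup_add_inf Dz // addr0.
  have : riesz_sup x z <=L riesz_sup s z.
    by apply: rsup_le; [exact: rle_trans (s1 _ Dx) (rlesup_l _ _)|exact: rlesup_r].
  by rewrite e => h; apply: (rle_shift h); module_identity.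
move=> h; have := rsup_add_inf s z; set i := riesz_inf s z => e.
have -> : i = s + z - riesz_sup s z by rewrite -e; module_identity.
by apply: (rle_shift h); module_identity.
Qed.

Lemma disjointD d u v : 0 <=L d -> 0 <=L u -> 0 <=L v ->
  riesz_inf d u = 0 -> riesz_inf d v = 0 -> riesz_inf d (u + v) = 0.
Proof.
move=> d0 u0 v0 hu hv; apply: rle_anti; last by apply: rle_inf => //; exact: raddr_ge0.
by apply: (rle_trans (rinf_addr d0 u0 v0)); rewrite hu hv addr0.
Qed.

Lemma disjoint_mono d d' u u' : 0 <=L d -> 0 <=L u -> d <=L d' -> u <=L u' ->
  riesz_inf d' u' = 0 -> riesz_inf d u = 0.
Proof.
move=> d0 u0 hd hu h; apply: rle_anti; last exact: rle_inf.
by rewrite -h; exact: rinf_mono.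
Qed.

Lemma disjointZ d u c : 0 <=L d -> 0 <=L u -> 0 <= c ->
  riesz_inf d u = 0 -> riesz_inf d (c *: u) = 0.
Proof.
move=> d0 u0 c0 h.
have N n : riesz_inf d (n%:R *: u) = 0.
  elim: n => [|n IH].
    by rewrite scale0r; apply: rle_anti; [exact: rinf_le_r|exact: rle_inf].
  rewrite -natr1 scalerDl scale1r; apply: disjointD => //.
  exact: rscale_ge0.
apply: (disjoint_mono _ _ _ _ (N (Num.bound c))) => //; first exact: rscale_ge0.
by apply: rscale_le => //; apply: ltW; have := archi_boundP c0.
Qed.

(** A disjoint sum is a supremum. *)
Lemma disjoint_sum_le y (e : nat -> E) n : (forall i, 0 <=L e i) ->
  (forall i, (i < n)%N -> e i <=L y) ->
  (forall i j, (i < j < n)%N -> riesz_inf (e i) (e j) = 0) -> 0 <=L y ->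
  \sum_(i < n) e i <=L y.
Proof.
move=> e0 ey ed y0; elim: n ey ed => [|n IH] ey ed; first by rewrite big_ord0.
have dis m : (m <= n)%N -> riesz_inf (e n) (\sum_(i < m) e i) = 0.
  elim: m => [_|m IHm mn]; first by rewrite big_ord0; apply: rle_anti;
    [exact: rinf_le_r|exact: rle_inf].
  rewrite big_ord_recr; apply: disjointD => //; last first.
  - by rewrite rinfC; apply: ed; rewrite mn /=.
  - exact: IHm (ltnW mn).
  - by elim/big_ind : _ => // *; exact: raddr_ge0.
rewrite big_ord_recr /=; have := rsup_add_inf (e n) (\sum_(i < n) e i).
rewrite dis // addr0 addrC => <-; apply: rsup_le; first exact: ey.
apply: IH => [i hi|i j /andP[ij jn]]; first by apply: ey; exact: ltnW.
by apply: ed; rewrite ij ltnW.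
Qed.

(** A bound valid for all choices of signs is valid for the choice that turns
every term into its modulus. *)
Lemma sum_modulus_le_signs (s : seq nat) (x : nat -> E) v : uniq s ->
  (forall c : nat -> R, (forall i, `|c i| = 1) ->
    \sum_(i <- s) c i *: x i <=L v) ->
  \sum_(i <- s) modulus (x i) <=L v.
Proof.
move=> us h.
suff gen w : (forall c : nat -> R, (forall i, `|c i| = 1) ->
    w + \sum_(i <- s) c i *: x i <=L v) ->
  w + \sum_(i <- s) modulus (x i) <=L v.
  by rewrite -[X in X <=L _]add0r; apply: gen => c hc; rewrite add0r; exact: h.
move=> {h}; elim: s us w => [_|k s IH /andP[ks us]] w h.
  by have := h (fun=> 1) (fun=> normr1 _); rewrite !big_nil.
have sgn a : `|a| = 1 -> w + a *: x k + \sum_(i <- s) modulus (x i) <=L v.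
  move=> ha; apply: (IH us (w + a *: x k)) => c hc.
  have := h (fun i => if i == k then a else c i) _; rewrite big_cons eqxx addrA.
  rewrite [in X in _ -> X](eq_big_seq (fun i => (if i == k then a else c i) *: x i)).
    by apply => i; case: ifP.
  by move=> i si; case: eqP => // ik; rewrite -ik si in ks.
rewrite big_cons.
have : modulus (x k) <=L v - w - \sum_(i <- s) modulus (x i).
  have s1 := sgn 1 (normr1 _).
  have s2 : w - 1 *: x k + \sum_(i <- s) modulus (x i) <=L v.
    by rewrite -scaleNr; apply: sgn; rewrite normrN normr1.
  by apply: modulus_le; [apply: (rle_shift s1)|apply: (rle_shift s2)]; module_identity.
by move=> hm; apply: (rle_shift hm); module_identity.
Qed.

End RieszSpaces.

#[local] Hint Resolve rle_refl modulus_ge0 pospart_ge0 : core.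

(** * Order completeness *)

Section BanachLatticeOrder.
Context {R : realType} {E : banachLatticeType R}.
Implicit Types (x y z u v w : E) (a c : R).

Lemma modulus_le_norm x y : modulus x <=L y -> `|x| <= `|y|.
Proof. by move=> h; apply: lattice_norm; exact: rle_trans h (rle_modulus _). Qed.

Lemma rle_norm x y : 0 <=L x -> x <=L y -> `|x| <= `|y|.
Proof. by move=> x0 xy; apply: modulus_le_norm; rewrite ger0_modulus. Qed.

Lemma norm_modulus x : `|modulus x| = `|x|.
Proof. by apply/eqP; rewrite eq_le !lattice_norm // modulus_id. Qed.

Lemma norm_arbitrarily_small x : (forall e : R, 0 < e -> `|x| <= e) -> x = 0.
Proof.
move=> h; apply/eqP; rewrite -normr_le0 leNgt; apply/negP => x0.
have := h (`|x| / 2); rewrite divr_gt0 // => /(_ isT); lra.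
Qed.

(** The negative cone is closed: the positive part of [x] is below [modulus w]. *)
Lemma rle0_approx x :
  (forall e : R, 0 < e -> exists2 w, x <=L w & `|w| <= e) -> x <=L 0.
Proof.
move=> h; suff <- : pospart x = 0 by exact: rlesup_l.
apply: norm_arbitrarily_small => e e0; have [w xw we] := h e e0.
apply: le_trans we; rewrite -[X in _ <= X]norm_modulus; apply: rle_norm => //.
by apply: rsup_le => //; exact: rle_trans xw (rle_modulus _).
Qed.

Lemma archimedean_le0 x w : (forall n : nat, n%:R *: x <=L w) -> x <=L 0.
Proof.
move=> h; apply: rle0_approx => e e0.
have [n hn] : exists n : nat, `|w| / e < n.+1%:R.
  exists (Num.bound (`|w| / e)); apply: lt_le_trans (archi_boundP _) _.
    by rewrite divr_ge0 // ltW.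
  by rewrite ler_nat.
exists (n.+1%:R^-1 *: w).
  have := @rleZ _ _ n.+1%:R^-1 _ _ _ (h n.+1); rewrite scalerA mulVf // scale1r.
  by apply; rewrite invr_ge0.
rewrite normrZ ger0_norm ?invr_ge0 // mulrC ler_pdivrMr //.
by rewrite ltr_pdivrMr // in hn; rewrite mulrC ltW.
Qed.

(** With an order continuous norm the differences between the upper bounds of an
upward directed set and its elements decrease to zero, so that they are small in
norm.  The upper bounds and the elements then have a common limit. *)
Lemma directed_lub (hE : order_continuous_norm E) (D : set E) b :
  D !=set0 -> (forall x y, D x -> D y -> exists z, [/\ D z, x <=L z & y <=L z]) ->
  (forall x, D x -> x <=L b) ->
  exists2 s, is_lub D s &
    forall e : R, 0 < e -> exists2 x, D x & `|s - x| < e.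
Proof.
move=> [x0 Dx0] dirD Db.
pose UB := [set u : E | forall x, D x -> x <=L u].
pose G := [set d | exists u x, [/\ UB u, D x & d = u - x]].
have dirG : downward_directed G.
  split; first by exists (b - x0), b, x0.
  move=> _ _ [u [x [Uu Dx ->]]] [v [y [Uv Dy ->]]].
  have [z [Dz xz yz]] := dirD _ _ Dx Dy.
  exists (riesz_inf u v - z); split.
  - by exists (riesz_inf u v), z; split => // w Dw; apply: rle_inf; [exact: Uu|exact: Uv].
  - by apply: (rle_shift (rleD (rinf_le_l u v) xz)); module_identity.
  - by apply: (rle_shift (rleD (rinf_le_r u v) yz)); module_identity.
have infG : is_inf G 0.
  split; first by move=> _ [u [x [Uu Dx ->]]]; apply/rsub_ge0; exact: Uu.
  move=> c hc; apply: (@archimedean_le0 c (b - x0)) => n.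
  suff : UB (b - n%:R *: c).
    by move=> /(_ _ Dx0) h; apply: (rle_shift h); module_identity.
  elim: n => [|n IH] x Dx; first by rewrite scale0r subr0; exact: Db.
  have := hc (b - n%:R *: c - x) _; rewrite -natr1 => /(_ _)/rle_shift; apply.
    by exists (b - n%:R *: c), x.
  by module_identity.
have near (e : R) : 0 < e -> exists u x, [/\ UB u, D x & `|u - x| < e].
  move=> /(hE _ dirG infG)[_ [u [x [Uu Dx ->]]] /(_ (u - x)) h].
  by exists u, x; split => //; apply: h => //; exists u, x.
have /choice[u /choice[x hux]] : forall n, exists u, exists x,
    [/\ UB u, D x & `|u - x| < (n.+1%:R^-1 : R)] by move=> n; apply: near; rewrite invr_gt0.
have ux n m : `|u n - u m| <= n.+1%:R^-1 + m.+1%:R^-1.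
  have [Un Dn hn] := hux n; have [Um Dm hm] := hux m.
  have hl p q : u p - u q <=L modulus (u p - x p) + modulus (u q - x q).
    have [Up Dp _] := hux p; have [Uq Dq _] := hux q.
    have := rleD (rle_modulus (u p - x p)) (modulus_ge0 (u q - x q)).
    apply: rle_trans; apply: (rle_shift (Uq _ Dp)); module_identity.
  apply: le_trans (_ : `|modulus (u n - x n) + modulus (u m - x m)| <= _).
    apply: modulus_le_norm; apply: modulus_le; first exact: hl.
    by rewrite opprB [X in _ <=L X]addrC; exact: hl.
  by apply: le_trans (ler_normD _ _) _; rewrite !norm_modulus; apply: lerD; exact: ltW.
have cu : cvg (u @ \oo).
  apply/cauchy_cvgP/cauchy_exP => e e0.
  have [N hN] : exists N : nat, 2 / e < N.+1%:R.
    exists (Num.bound (2 / e)); apply: lt_le_trans (archi_boundP _) _.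
      by rewrite divr_ge0 // ltW.
    by rewrite ler_nat.
  have hN' : N.+1%:R^-1 < e / 2.
    by rewrite -[e / 2]invrK ltf_pV2 ?posrE ?invr_gt0 ?divr_gt0 // invf_div.
  exists (u N), N => // n /= Nn; rewrite -ball_normE /=.
  apply: le_lt_trans (ux N n) _; apply: lt_le_trans (_ : e / 2 + e / 2 <= _).
    apply: ltrD => //; apply: le_lt_trans hN'.
    by rewrite lef_pV2 ?posrE // ler_nat.
  by rewrite -splitr.
pose s := lim (u @ \oo).
have us (e : R) : 0 < e -> exists n, `|u n - s| < e /\ `|u n - x n| < e.
  move=> e0; have /cvgrPdist_lt/(_ _ e0) [N _ hN] : u @ \oo --> s by [].
  have [M hM] : exists M : nat, e^-1 < M.+1%:R.
    exists (Num.bound e^-1); apply: lt_le_trans (archi_boundP _) _.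
      by rewrite invr_ge0 ltW.
    by rewrite ler_nat.
  exists (maxn N M); split.
    by rewrite distrC; apply: hN; rewrite /= leq_maxl.
  have [_ _ /lt_trans] := hux (maxn N M); apply.
  rewrite -[e]invrK ltf_pV2 ?posrE ?invr_gt0 //; apply: lt_le_trans hM _.
  by rewrite ler_nat ltnS leq_maxr.
exists s; last first.
  move=> e e0; have [|n [h1 h2]] := us (e / 2); first by rewrite divr_gt0.
  have [_ Dn _] := hux n; exists (x n) => //.
  rewrite (_ : s - x n = (u n - x n) - (u n - s)); last by module_identity.
  by apply: le_lt_trans (ler_normB _ _) _; lra.
split.
  move=> z Dz; suff : z - s <=L 0 by move=> h; apply: (rle_shift h); module_identity.
  apply: rle0_approx => e /us[n [h _]]; exists (u n - s); last exact: ltW.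
  by apply: rleD => //; have [Un _ _] := hux n; exact: Un.
move=> c hc; suff : s - c <=L 0 by move=> h; apply: (rle_shift h); module_identity.
apply: rle0_approx => e e0; have [|n [h1 h2]] := us (e / 2); first by rewrite divr_gt0.
have [_ Dn _] := hux n.
exists ((u n - x n) - (u n - s)).
  by apply: (rle_shift (hc _ Dn)); module_identity.
by apply: le_trans (ler_normB _ _) _; lra.
Qed.

(** Closing a set under binary suprema makes it directed and keeps its upper
bounds. *)
Inductive sup_closure (D : set E) : set E :=
  | sup_closure_in x : D x -> sup_closure D x
  | sup_closure_sup x y :
      sup_closure D x -> sup_closure D y -> sup_closure D (riesz_sup x y).

Lemma order_complete (hE : order_continuous_norm E) (D : set E) b :
  D !=set0 -> (forall x, D x -> x <=L b) -> exists s, is_lub D s.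
Proof.
move=> [x0 Dx0] Db.
have ub w : (forall x, D x -> x <=L w) -> forall x, sup_closure D x -> x <=L w.
  by move=> hc x; elim=> [y /hc//|y z _ hy _ hz]; exact: rsup_le.
have [||//|s [s1 s2] _] := @directed_lub hE (sup_closure D) b; last 2 first.
- exact: ub.
- exists s; split => [x Dx|c hc]; first by apply: s1; exact: sup_closure_in.
  by apply: s2; exact: ub.
- by exists x0; exact: sup_closure_in.
- move=> x y Dx Dy; exists (riesz_sup x y).
  by split; [exact: sup_closure_sup|exact: rlesup_l|exact: rlesup_r].
Qed.

End BanachLatticeOrder.

(** * Regular operators and kernel operators *)

Section RegularOperators.
Context {R : realType} {E : banachLatticeType R}.
Hypothesis hE : order_continuous_norm E.
Implicit Types (x y z u v w : E) (S T U V W K : {linear E -> E}).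

Definition order_interval x : set E := [set z | 0 <=L z /\ z <=L x].

(** The Riesz-Kantorovich formula.  Additivity on the positive cone comes from the
Riesz decomposition of an element below a sum. *)
Lemma riesz_kantorovich W :
  (forall x, 0 <=L x -> exists u, forall z, order_interval x z -> W z <=L u) ->
  exists Q : {linear E -> E}, forall x, 0 <=L x -> is_lub (W @` order_interval x) (Q x).
Proof.
move=> Wb.
have /choice[q hq] : forall x, exists s, 0 <=L x -> is_lub (W @` order_interval x) s.
  move=> x; case: (pselect (0 <=L x)) => [x0|]; last by exists 0.
  have [u hu] := Wb x x0.
  have [||s hs] := @order_complete _ _ hE (W @` order_interval x) u.
  - by exists (W 0), 0.
  - by move=> _ [z hz <-]; exact: hu.
  - by exists s.
have qle x z : 0 <=L x -> order_interval x z -> W z <=L q x.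
  by move=> x0 hz; have [h _] := hq x x0; apply: h; exists z.
have qlub x b : 0 <=L x -> (forall z, order_interval x z -> W z <=L b) -> q x <=L b.
  by move=> x0 hb; have [_ h] := hq x x0; apply: h => _ [z hz <-]; exact: hb.
have qD x y : 0 <=L x -> 0 <=L y -> q (x + y) = q x + q y.
  move=> x0 y0; have xy0 := raddr_ge0 x0 y0; apply: rle_anti.
    apply: (qlub _ _) => // z [z0 zxy].
    have h1 : order_interval x (riesz_inf z x).
      by split; [exact: rle_inf|exact: rinf_le_r].
    have h2 : order_interval y (z - riesz_inf z x).
      split; first by apply/rsub_ge0; exact: rinf_le_l.
      suff h : z - y <=L riesz_inf z x by apply: (rle_shift h); module_identity.
      apply: rle_inf; first by apply: (rle_shift y0); module_identity.
      by apply: (rle_shift zxy); module_identity.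
    have := rleD (qle _ _ x0 h1) (qle _ _ y0 h2).
    by rewrite -linearD addrC subrK.
  suff h : q x <=L q (x + y) - q y by apply: (rle_shift h); module_identity.
  apply: (qlub _ _) => // z [z0 zx].
  suff h : q y <=L q (x + y) - W z by apply: (rle_shift h); module_identity.
  apply: (qlub _ _) => // t [t0 ty].
  have h : order_interval (x + y) (z + t) by split; [exact: raddr_ge0|exact: rleD].
  by apply: (rle_shift (qle _ _ xy0 h)); rewrite linearD; module_identity.
have qZ (a : R) x : 0 <= a -> 0 <=L x -> q (a *: x) = a *: q x.
  have le (c : R) y : 0 < c -> 0 <=L y -> q (c *: y) <=L c *: q y.
    move=> c0 y0; have ci : 0 <= c^-1 by rewrite invr_ge0 ltW.
    apply: (qlub _ _); first by apply: rscale_ge0 => //; exact: ltW.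
    move=> z [z0 zy]; have h : order_interval y (c^-1 *: z).
      split; first exact: rscale_ge0.
      by have := rleZ ci zy; rewrite scalerA mulVf ?gt_eqF // scale1r.
    have := rleZ (ltW c0) (qle _ _ y0 h).
    by rewrite linearZ /= scalerA mulfV ?gt_eqF // scale1r.
  rewrite le_eqVlt => /predU1P[<-|a0] x0.
    rewrite !scale0r; have := qD 0 0 (rle_refl _) (rle_refl _); rewrite addr0 => h.
    by apply: (addrI (q 0)); rewrite -h addr0.
  apply: rle_anti; first exact: le.
  have ai : 0 < a^-1 by rewrite invr_gt0.
  have ax : 0 <=L a *: x by apply: rscale_ge0 => //; exact: ltW.
  have := rleZ (ltW a0) (le _ _ ai ax).
  by rewrite !scalerA mulVf ?mulfV ?gt_eqF // !scale1r.
pose F x := q (pospart x) - q (pospart (- x)).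
have FE u v : 0 <=L u -> 0 <=L v -> F (u - v) = q u - q v.
  move=> u0 v0; have h : q (u + pospart (- (u - v))) = q (v + pospart (u - v)).
    congr q; have e := pospart_sub (u - v).
    have -> : u + pospart (- (u - v)) = v + (u - v) + pospart (- (u - v)) by module_identity.
    by rewrite -{1}e; module_identity.
  rewrite !qD // in h; rewrite /F.
  have -> : q u = (q u + q (pospart (- (u - v)))) - q (pospart (- (u - v))) by module_identity.
  by rewrite h; module_identity.
have FD x y : F (x + y) = F x + F y.
  have e : x + y = (pospart x + pospart y) - (pospart (- x) + pospart (- y)).
    by rewrite -{1}(pospart_sub x) -{1}(pospart_sub y); module_identity.
  rewrite e FE ?qD //; try exact: raddr_ge0.
  by rewrite /F; module_identity.
have FZ (a : R) x : F (a *: x) = a *: F x.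
  case: (lerP 0 a) => a0.
    have e : a *: x = a *: pospart x - a *: pospart (- x).
      by rewrite -{1}(pospart_sub x); module_identity.
    by rewrite e FE ?qZ //; [rewrite /F scalerBr|exact: rscale_ge0|exact: rscale_ge0].
  have Na : 0 <= - a by rewrite oppr_ge0 ltW.
  have e : a *: x = (- a) *: pospart (- x) - (- a) *: pospart x.
    by rewrite -{1}(pospart_sub x); module_identity.
  rewrite e FE ?qZ //; [|exact: rscale_ge0|exact: rscale_ge0].
  by rewrite /F; module_identity.
have Flin : linear F by move=> a x y; rewrite FD FZ.
pose Q : {linear E -> E} := HB.pack_for {linear E -> E} F (GRing.isLinear.Build R E E *:%R F Flin).
exists Q => x x0; suff -> : Q x = q x by exact: hq.
have := FE x 0 x0 (rle_refl _); rewrite subr0 => e; rewrite -[LHS]/(F x) e.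
suff -> : q 0 = 0 by rewrite subr0.
by have := qZ 0 0 (lexx _) (rle_refl _); rewrite !scale0r.
Qed.

(** Finite rank operators take the unit ball into an order interval; this is the only
trace of the kernel in the estimates. *)
Lemma finite_rank_norm_dominated T : finite_rank_op T ->
  exists2 u, 0 <=L u & forall x, modulus (T x) <=L `|x| *: u.
Proof.
move=> [n [phi [y [cphi hT]]]].
have /choice[C hC] : forall i, exists C : R, 0 <= C /\ forall x, `|phi i x : R| <= C * `|x|.
  move=> i; have := (linear_boundedP (phi i)).1 (continuous_linear_bounded 0 (cphi i 0)).
  move=> [C [_ hC]]; exists (`|C| + 1); split; first by rewrite addr_ge0.
  by apply: hC; apply: le_lt_trans (ler_norm _) _; rewrite ltrDl.
exists (\sum_(i < n) C i *: modulus (y i)).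
  elim/big_ind : _ => // [*|i _]; first exact: raddr_ge0.
  by have [h _] := hC i; apply: rscale_ge0.
move=> x; rewrite hT scaler_sumr.
elim/big_rec2 : _ => [|i u v _ h]; first by rewrite modulus0.
apply: (rle_trans (modulusD _ _)); apply: rleD => //.
rewrite modulusZ scalerA; apply: rscale_le => //.
by have [_ hx] := hC i; rewrite mulrC.
Qed.

Lemma positive_regular T : positive_op T -> regular_op T.
Proof.
move=> T0; have h : linear (fun _ : E => 0 : E) by move=> a x y; rewrite scaler0 addr0.
pose O : {linear E -> E} :=
  HB.pack_for {linear E -> E} (fun _ : E => 0 : E) (GRing.isLinear.Build R E E *:%R _ h).
by exists T, O; split => // x; rewrite (_ : O x = 0) // subr0.
Qed.

(** A positive operator [K <> 0] in the band generated by the finite rank operators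
is not disjoint from all of them: otherwise it would be disjoint from itself.  The
positive part [Q] of a common lower bound of [K] and of the modulus of a finite rank
operator is then nonzero. *)
Lemma kernel_op_minorant K : kernel_op K -> positive_op K -> ~ (forall x, K x = 0) ->
  exists Q : {linear E -> E}, [/\ positive_op Q, op_le Q K, ~ (forall x, Q x = 0) &
    exists2 u, 0 <=L u & forall x, 0 <=L x -> Q x <=L `|x| *: u].
Proof.
move=> [Kreg Kbb] K0 Kn0.
have [T [Tfr Tnd]] : exists T, finite_rank_op T /\ ~ disjoint_op K T.
  apply: contrapT => hno; apply: Kn0.
  have /Kbb [U [V [hU hV [_ UV1 UV2 hinf]]]] :
      disjoint_compl [set T | finite_rank_op T] K.
    split => // T hT; apply: contrapT => hd; apply: hno; by exists T.
  have [_ KU _ _] := hU; have [_ KV _ _] := hV.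
  have K_le0 := hinf K Kreg KU KV.
  move=> x; rewrite -[x]pospart_sub linearB.
  have h z : 0 <=L z -> K z = 0 by move=> z0; apply: rle_anti; [exact: K_le0|exact: K0].
  by rewrite /= !h // subrr.
have [u u0 hu] := finite_rank_norm_dominated Tfr.
have Tint x z : order_interval x z -> T z <=L `|x| *: u.
  move=> [z0 zx]; apply: (rle_trans (rle_modulus _)); apply: (rle_trans (hu z)).
  by apply: rscale_le => //; exact: rle_norm.
have [P hP] : exists P : {linear E -> E}, forall x, 0 <=L x ->
    is_lub (T @` order_interval x) (P x).
  by apply: riesz_kantorovich => x x0; exists (`|x| *: u) => z; exact: Tint.
have in0 x : 0 <=L x -> order_interval x 0 by split.
have inx x : 0 <=L x -> order_interval x x by split => //; exact: rle_refl.
have P0 x : 0 <=L x -> 0 <=L P x.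
  by move=> x0; have [h _] := hP x x0; apply: h; exists 0; rewrite ?linear0 //; exact: in0.
have TP x : 0 <=L x -> T x <=L P x.
  by move=> x0; have [h _] := hP x x0; apply: h; exists x => //; exact: inx.
have Pu x : 0 <=L x -> P x <=L `|x| *: u.
  by move=> x0; have [_ h] := hP x x0; apply: h => _ [z hz <-]; exact: Tint.
have Mlin : linear (fun x => P x + (P x - T x)).
  move=> a x y; rewrite !linearD !linearZ /=; module_identity.
pose M : {linear E -> E} := HB.pack_for {linear E -> E} (fun x => P x + (P x - T x))
  (GRing.isLinear.Build R E E *:%R _ Mlin).
have ME x : M x = P x + (P x - T x) by [].
have M0 : positive_op M.
  move=> x x0; rewrite ME; apply: raddr_ge0; first exact: P0.
  by apply/rsub_ge0; exact: TP.
have Mmod : regular_modulus T M.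
  split.
  - exact: positive_regular.
  - by move=> x x0; rewrite ME; apply: (rle_shift (rleD (TP _ x0) (TP _ x0))); module_identity.
  - move=> x x0; rewrite ME /=.
    by apply: (rle_shift (rleD (P0 _ x0) (P0 _ x0))); module_identity.
  move=> V _ TV NTV x x0; rewrite ME.
  have h : P x <=L 2^-1 *: (V x + T x).
    have [_ h] := hP x x0; apply: h => _ [z [z0 zx] <-].
    have h2 : 0 <= 2^-1 :> R by rewrite invr_ge0.
    have i1 := TV z z0; have /rsub_ge0 xz : z <=L x by [].
    have i2 := NTV _ xz; rewrite /= !linearB /= in i2.
    by apply: (rle_shift (rleZ h2 (rleD i1 i2))); module_identity.
  by apply: (rle_shift (rleD h h)); module_identity.
have Kself : regular_modulus K K.
  split => //.
  by move=> x x0 /=; apply: (rle_shift (rleD (K0 _ x0) (K0 _ x0))); module_identity.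
have [W [WK WM [x1 x1_ge0 Wx1]]] : exists W, [/\ op_le W K, op_le W M &
    exists2 x, 0 <=L x & ~ W x <=L 0].
  apply: contrapT => hno; apply: Tnd; exists K, M; split => //; split.
  - by apply: positive_regular => x _; exact: rle_refl.
  - exact: K0.
  - exact: M0.
  move=> W _ WK WM x x0; apply: contrapT => hW; apply: hno.
  by exists W; split => //; exists x.
have Wint x z : order_interval x z -> W z <=L K x.
  move=> [z0 zx]; apply: (rle_trans (WK _ z0)).
  by have /K0 := (rsub_ge0 _ _).2 zx; rewrite linearB /= => /rsub_ge0.
have [Q hQ] : exists Q : {linear E -> E}, forall x, 0 <=L x ->
    is_lub (W @` order_interval x) (Q x).
  by apply: riesz_kantorovich => x x0; exists (K x) => z; exact: Wint.
have Qle x b : 0 <=L x -> (forall z, order_interval x z -> W z <=L b) -> Q x <=L b.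
  by move=> x0 hb; have [_ h] := hQ x x0; apply: h => _ [z hz <-]; exact: hb.
have WQ x : 0 <=L x -> W x <=L Q x.
  by move=> x0; have [h _] := hQ x x0; apply: h; exists x => //; exact: inx.
exists Q; split.
- by move=> x x0; have [h _] := hQ x x0; apply: h; exists 0; rewrite ?linear0 //; exact: in0.
- by move=> x x0; apply: Qle => // z; exact: Wint.
- by move=> Q0; apply: Wx1; rewrite -(Q0 x1); exact: WQ.
exists (2 *: u + u); first by apply: raddr_ge0 => //; exact: rscale_ge0.
move=> x x0; apply: Qle => // z [z0 zx]; apply: (rle_trans (WM _ z0)); rewrite ME.
have nz : `|z| *: u <=L `|x| *: u by apply: rscale_le => //; exact: rle_norm.
have h1 := rle_trans (Pu _ z0) nz.
have h2 : - T z <=L `|x| *: u.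
  exact: rle_trans (rleN_modulus _) (rle_trans (hu z) nz).
by apply: (rle_shift (rleD (rleD h1 h1) h2)); module_identity.
Qed.

End RegularOperators.

(** * Positive bounded semigroups and their Cesaro means *)

Lemma archi_pow2 {R : realType} (c : R) : exists n : nat, c < 2 ^+ n.
Proof.
exists (Num.bound `|c|); apply: le_lt_trans (ler_norm c) _.
apply: lt_trans (archi_boundP (normr_ge0 c)) _.
by rewrite -natrX ltr_nat ltn_expl.
Qed.

Section PositiveSemigroup.
Context {R : realType} {E : banachLatticeType R}.
Variables (P : R -> {linear E -> E}) (M : R).
Hypothesis P_at0 : forall x, P 0 x = x.
Hypothesis P_add :
  forall t s : R, 0 <= t -> 0 <= s -> forall x, P (t + s) x = P t (P s x).
Hypothesis P_pos : positive_semigroup P.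
Hypothesis M_ge0 : 0 <= M.
Hypothesis P_bounded : forall t : R, 0 <= t -> forall x, `|P t x| <= M * `|x|.
Implicit Types (x y z u v w : E) (a b c e t s : R).

Lemma semigroup_le t x y : 0 <= t -> x <=L y -> P t x <=L P t y.
Proof.
by move=> t0 /rsub_ge0/(P_pos t0); rewrite linearB => /rsub_ge0.
Qed.

Lemma semigroup_modulus t x : 0 <= t -> modulus (P t x) <=L P t (modulus x).
Proof.
move=> t0; apply: modulus_le; first exact/semigroup_le/rle_modulus.
by rewrite -linearN; apply/semigroup_le/rleN_modulus.
Qed.

Lemma semigroup_comm t s x : 0 <= t -> 0 <= s -> P t (P s x) = P s (P t x).
Proof. by move=> t0 s0; rewrite -!P_add // addrC. Qed.

(** Cesaro means over the times [j / 2 ^ n] up to [2 ^ n]: the steps get finer and the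
time span longer, so that shifting by any fixed dyadic time changes little. *)
Definition dyadic_mean n x : E :=
  (2 ^+ n * 2 ^+ n)^-1 *: \sum_(j < 2 ^ n * 2 ^ n) P (j%:R / 2 ^+ n) x.

Let weight_ge0 n : 0 <= (2 ^+ n * 2 ^+ n)^-1 :> R.
Proof. by rewrite invr_ge0 mulr_ge0 // exprn_ge0. Qed.

Lemma dyadic_meanD n x y : dyadic_mean n (x + y) = dyadic_mean n x + dyadic_mean n y.
Proof.
rewrite /dyadic_mean -scalerDr -big_split; congr (_ *: _).
by apply: eq_bigr => j _; rewrite linearD.
Qed.

Lemma dyadic_meanZ n a x : dyadic_mean n (a *: x) = a *: dyadic_mean n x.
Proof.
rewrite /dyadic_mean scalerA [a * _]mulrC -scalerA; congr (_ *: _).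
by rewrite scaler_sumr; apply: eq_bigr => j _; rewrite linearZ.
Qed.

Lemma dyadic_meanB n x y : dyadic_mean n (x - y) = dyadic_mean n x - dyadic_mean n y.
Proof. by rewrite dyadic_meanD -scaleN1r dyadic_meanZ scaleN1r. Qed.

Lemma dyadic_mean_ge0 n x : 0 <=L x -> 0 <=L dyadic_mean n x.
Proof.
move=> x0; apply: rscale_ge0 => //; elim/big_ind : _ => // *; first exact: raddr_ge0.
exact: P_pos.
Qed.

Lemma dyadic_mean_le n x y : x <=L y -> dyadic_mean n x <=L dyadic_mean n y.
Proof. by move=> /rsub_ge0/dyadic_mean_ge0 h; apply/rsub_ge0; rewrite -dyadic_meanB. Qed.

Let weight_sum n x : (2 ^+ n * 2 ^+ n)^-1 *: (x *+ (2 ^ n * 2 ^ n)) = x.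
Proof.
rewrite -[x *+ _]scaler_nat scalerA natrM !natrX mulVf ?scale1r //.
Qed.

Lemma dyadic_mean_norm n x : `|dyadic_mean n x| <= M * `|x|.
Proof.
rewrite normrZ ger0_norm // -[X in _ <= X](@mulKf _ (2 ^+ n * 2 ^+ n)) ?mulf_neq0 ?expf_neq0 //.
apply: ler_wpM2l => //; apply: le_trans (ler_norm_sum _ _ _) _.
apply: le_trans (_ : \sum_(j < 2 ^ n * 2 ^ n) M * `|x| <= _).
  by apply: ler_sum => j _; exact: P_bounded.
by rewrite sumr_const card_ord -[X in X <= _]mulr_natl natrM !natrX.
Qed.

Lemma dyadic_mean_comm n t x : 0 <= t -> dyadic_mean n (P t x) = P t (dyadic_mean n x).
Proof.
move=> t0; rewrite /dyadic_mean linearZ /=; congr (_ *: _).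
by rewrite linear_sum; apply: eq_bigr => j _; exact: semigroup_comm.
Qed.

Lemma dyadic_mean_subinvariant n x : (forall t, 0 <= t -> x <=L P t x) ->
  x <=L dyadic_mean n x.
Proof.
move=> h; have : \sum_(j < 2 ^ n * 2 ^ n) x <=L \sum_(j < 2 ^ n * 2 ^ n) P (j%:R / 2 ^+ n) x.
  by elim/big_rec2 : _ => // j y1 y2 _ hy; apply: rleD => //; exact: h.
move=> /(rleZ (weight_ge0 n)); apply: rle_trans.
by rewrite sumr_const card_ord weight_sum.
Qed.

Definition mean_null x := forall e, 0 < e ->
  exists N : nat, forall n, (N <= n)%N -> `|dyadic_mean n x| <= e.

Lemma mean_nullD x y : mean_null x -> mean_null y -> mean_null (x + y).
Proof.
move=> hx hy e e0; have e2 : 0 < e / 2 by rewrite divr_gt0.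
have [N1 h1] := hx _ e2; have [N2 h2] := hy _ e2.
exists (maxn N1 N2) => n; rewrite geq_max => /andP[n1 n2].
rewrite dyadic_meanD (le_trans (ler_normD _ _)) //.
by rewrite [e]splitr lerD ?h1 ?h2.
Qed.

Lemma mean_null0 : mean_null 0.
Proof.
move=> e e0; exists 0%N => n _.
by rewrite -(scale0r (0 : E)) dyadic_meanZ scale0r normr0 ltW.
Qed.

Lemma mean_nullZ a x : mean_null x -> mean_null (a *: x).
Proof.
move=> hx e e0; have a0 : 0 < `|a| + 1 by rewrite ltr_wpDl.
have [N h] := hx (e / (`|a| + 1)) (divr_gt0 e0 a0).
exists N => n /h; rewrite ler_pdivlMr // => {}h; apply: le_trans h.
by rewrite dyadic_meanZ (normrZ a) mulrC; apply: ler_wpM2l => //; lra.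
Qed.

Lemma mean_step n x :
  dyadic_mean n (P (2 ^+ n)^-1 x - x) =
  (2 ^+ n * 2 ^+ n)^-1 *: (P ((2 ^ n * 2 ^ n)%:R / 2 ^+ n) x - x).
Proof.
rewrite /dyadic_mean; congr (_ *: _).
elim: (2 ^ n * 2 ^ n)%N => [|k IH]; first by rewrite big_ord0 mul0r P_at0 subrr.
rewrite big_ord_recr IH /= linearB -P_add ?invr_ge0 ?exprn_ge0 //.
have -> : k%:R / 2 ^+ n + (2 ^+ n)^-1 = k.+1%:R / 2 ^+ n :> R.
  by rewrite -[k.+1%:R]natr1 mulrDl mul1r.
module_identity.
Qed.

Lemma mean_shift_norm n d x :
  `|dyadic_mean n (P (d%:R / 2 ^+ n) x - x)| <=
  d%:R * ((2 ^+ n * 2 ^+ n)^-1 * ((M + 1) * (M * `|x|))).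
Proof.
elim: d => [|d IH].
  by rewrite mul0r P_at0 subrr -(scale0r (0 : E)) dyadic_meanZ scale0r normr0 mul0r.
have -> : P (d.+1%:R / 2 ^+ n) x - x =
    (P (2 ^+ n)^-1 (P (d%:R / 2 ^+ n) x) - P (d%:R / 2 ^+ n) x) +
    (P (d%:R / 2 ^+ n) x - x).
  rewrite -P_add ?invr_ge0 ?exprn_ge0 //.
  have -> : (2 ^+ n)^-1 + d%:R / 2 ^+ n = d.+1%:R / 2 ^+ n :> R.
    by rewrite -[d.+1%:R]natr1 mulrDl mul1r addrC.
  module_identity.
rewrite dyadic_meanD -[d.+1%:R]natr1 mulrDl mul1r addrC.
apply: (le_trans (ler_normD _ _)); apply: lerD => //.
rewrite mean_step normrZ ger0_norm //; apply: ler_wpM2l => //.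
apply: (le_trans (ler_normB _ _)); rewrite mulrDl mul1r lerD //; last exact: P_bounded.
by apply: (le_trans (P_bounded _ _)) => //; rewrite ler_wpM2l // P_bounded.
Qed.

Lemma mean_null_shift k j x : mean_null (P (j%:R / 2 ^+ k) x - x).
Proof.
move=> e e0; pose C := (M + 1) * (M * `|x|).
have C0 : 0 <= C by rewrite !mulr_ge0 // addr_ge0.
have [N hN] := archi_pow2 (j%:R * C / e).
exists (maxn k N) => n; rewrite geq_max => /andP[kn Nn].
have -> : j%:R / 2 ^+ k = (j * 2 ^ (n - k))%:R / 2 ^+ n :> R.
  rewrite natrM natrX -mulrA; congr (_ * _).
  by rewrite -{2}(subnK kn) exprD invfM mulrA mulfV ?mul1r // expf_neq0.
apply: (le_trans (mean_shift_norm _ _ _)); rewrite -/C natrM natrX.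
apply: le_trans (_ : j%:R * 2 ^+ n * ((2 ^+ n * 2 ^+ n)^-1 * C) <= _).
  apply: ler_wpM2r; first by rewrite mulr_ge0.
  by apply: ler_wpM2l => //; apply: ler_weXn2l; rewrite ?ler1n // leq_subr.
have -> : j%:R * 2 ^+ n * ((2 ^+ n * 2 ^+ n)^-1 * C) = j%:R * C / 2 ^+ n :> R.
  by field; rewrite expf_neq0.
rewrite ler_pdivrMr ?exprn_gt0 // [e * _]mulrC -ler_pdivrMr //.
by apply: le_trans (ltW hN) _; apply: ler_weXn2l => //; rewrite ler1n.
Qed.

Let eventual_bounds x : set R :=
  [set c | exists N : nat, forall n, (N <= n)%N -> `|dyadic_mean n (modulus x)| <= c].

Let eventual_bounds_inf x : has_inf (eventual_bounds x).
Proof.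
split; first by exists (M * `|modulus x|), 0%N => n _; exact: dyadic_mean_norm.
by exists 0 => c [N /(_ N (leqnn _))]; apply: le_trans.
Qed.

(** The upper limit of [`|dyadic_mean n (modulus x)|]. *)
Definition mean_norm x : R := inf (eventual_bounds x).

Lemma mean_norm_lb x c :
  (exists N : nat, forall n, (N <= n)%N -> `|dyadic_mean n (modulus x)| <= c) ->
  mean_norm x <= c.
Proof. by move=> h; apply: ge_inf => //; exact: (eventual_bounds_inf x).2. Qed.

Lemma mean_norm_eventually x e : 0 < e ->
  exists N : nat, forall n, (N <= n)%N ->
    `|dyadic_mean n (modulus x)| <= mean_norm x + e.
Proof.
move=> e0; have [c [N hN] hc] := inf_adherent e0 (eventual_bounds_inf x).
by exists N => n /hN /le_trans; apply; exact: ltW.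
Qed.

Lemma mean_norm_ge0 x : 0 <= mean_norm x.
Proof.
apply: lb_le_inf; first exact: (eventual_bounds_inf x).1.
by move=> c [N /(_ N (leqnn _))]; apply: le_trans.
Qed.

Lemma mean_norm_le_norm x : mean_norm x <= M * `|x|.
Proof.
by apply: mean_norm_lb; exists 0%N => n _; rewrite -(norm_modulus x) dyadic_mean_norm.
Qed.

(** Monotonicity, sublinearity and invariance of the seminorm in one estimate: the
error [w] disappears when means are taken. *)
Lemma mean_norm_dominated x a y b z w : 0 <= a -> 0 <= b -> mean_null w ->
  modulus x <=L a *: modulus y + b *: modulus z + w ->
  mean_norm x <= a * mean_norm y + b * mean_norm z.
Proof.
move=> a0 b0 hw hx; apply/ler_addgt0Pr => e e0.
have k0 : 0 < a + b + 1 by rewrite ltr_wpDl ?addr_ge0.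
have d0 := divr_gt0 e0 k0.
have [N1 h1] := mean_norm_eventually y d0.
have [N2 h2] := mean_norm_eventually z d0.
have [N3 h3] := hw _ d0.
apply: mean_norm_lb; exists (maxn N1 (maxn N2 N3)) => n.
rewrite !geq_max => /and3P[/h1{}h1 /h2{}h2 /h3{}h3].
apply: le_trans (_ : `|a *: dyadic_mean n (modulus y) + b *: dyadic_mean n (modulus z)
   + dyadic_mean n w| <= _).
  apply: rle_norm; first exact: dyadic_mean_ge0.
  by rewrite -!dyadic_meanZ -!dyadic_meanD; exact: dyadic_mean_le.
apply: (le_trans (ler_normD _ _)); apply: (le_trans (lerD (ler_normD _ _) h3)).
rewrite (normrZ a) (normrZ b) !ger0_norm //.
apply: (le_trans (lerD (lerD (ler_wpM2l a0 h1) (ler_wpM2l b0 h2)) (lexx _))).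
set d := e / _; have -> : e = (a + b + 1) * d by rewrite mulrC divfK ?gt_eqF.
by rewrite !mulrDl !mulrDr; lra.
Qed.

Lemma mean_norm_mono x y : modulus x <=L modulus y -> mean_norm x <= mean_norm y.
Proof.
move=> h; have := @mean_norm_dominated x 1 y 0 y 0 ler01 (lexx _) mean_null0.
by rewrite scale1r scale0r !addr0 mul1r mul0r addr0; apply.
Qed.

Lemma mean_norm_modulus x : mean_norm (modulus x) = mean_norm x.
Proof. by apply/eqP; rewrite eq_le !mean_norm_mono ?modulus_id. Qed.

Lemma mean_normD x y : mean_norm (x + y) <= mean_norm x + mean_norm y.
Proof.
have := @mean_norm_dominated (x + y) 1 x 1 y 0 ler01 ler01 mean_null0.
by rewrite !scale1r !mul1r addr0; apply; exact: modulusD.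
Qed.

Lemma mean_normZ a x : mean_norm (a *: x) <= `|a| * mean_norm x.
Proof.
have := @mean_norm_dominated (a *: x) `|a| x 0 x 0 (normr_ge0 _) (lexx _) mean_null0.
by rewrite scale0r !addr0 mul0r addr0 modulusZ; apply.
Qed.

Lemma mean_norm_scale_ge a x : 0 <= a -> a * mean_norm x <= mean_norm (a *: x).
Proof.
rewrite le_eqVlt => /predU1P[<-|a0]; first by rewrite mul0r mean_norm_ge0.
have := mean_normZ a^-1 (a *: x); rewrite scalerA mulVf ?gt_eqF // scale1r.
have ai : 0 <= a^-1 by rewrite invr_ge0 ltW.
by rewrite (ger0_norm ai) ler_pdivlMl.
Qed.

Lemma mean_norm_le_of_null x y : 0 <=L x -> 0 <=L y -> mean_null (x - y) ->
  mean_norm x <= mean_norm y.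
Proof.
move=> x0 y0 h; have := @mean_norm_dominated x 1 y 0 y _ ler01 (lexx _) h.
rewrite scale1r scale0r addr0 mul1r mul0r addr0; apply.
rewrite !ger0_modulus //; have -> : y + (x - y) = x by module_identity.
exact: rle_refl.
Qed.

Lemma mean_norm_null_eq0 x : 0 <=L x -> mean_null x -> mean_norm x = 0.
Proof.
move=> x0 hx; apply/eqP; rewrite eq_le mean_norm_ge0 andbT.
have := @mean_norm_dominated x 0 x 0 x _ (lexx _) (lexx _) hx.
by rewrite !scale0r !add0r !mul0r addr0 ger0_modulus //; apply.
Qed.

Lemma mean_norm_semigroup t x : 0 <= t -> mean_norm (P t x) <= M * mean_norm x.
Proof.
move=> t0; apply/ler_addgt0Pr => e e0.
have M1 : 0 < M + 1 by rewrite ltr_wpDl.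
have [N hN] := mean_norm_eventually x (divr_gt0 e0 M1).
apply: mean_norm_lb; exists N => n /hN h.
apply: le_trans (_ : `|P t (dyadic_mean n (modulus x))| <= _).
  apply: rle_norm; first exact: dyadic_mean_ge0.
  by rewrite -dyadic_mean_comm //; apply/dyadic_mean_le/semigroup_modulus.
apply: (le_trans (P_bounded _ _)) => //; apply: (le_trans (ler_wpM2l M_ge0 h)).
rewrite mulrDr lerD2l mulrA ler_pdivrMr // mulrDr mulr1 mulrC lerDl ltW //.
Qed.

Lemma mean_norm_subinvariant x : 0 <=L x -> (forall t, 0 <= t -> x <=L P t x) ->
  `|x| <= mean_norm x.
Proof.
move=> x0 h; apply: lb_le_inf; first exact: (eventual_bounds_inf x).1.
move=> c [N /(_ N (leqnn _))]; apply: le_trans; rewrite ger0_modulus //.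
by apply: rle_norm => //; exact: dyadic_mean_subinvariant.
Qed.

(** The kernel of the seminorm is a closed invariant ideal, and it does not contain
the subinvariant vector [y], whose means stay above [y]. *)
Lemma mean_norm_eq0 (hirr : irreducible_semigroup P) y : y <> 0 -> 0 <=L y ->
  (forall t, 0 <= t -> y <=L P t y) -> forall x, mean_norm x = 0 -> x = 0.
Proof.
move=> yn0 y0 hy.
have lei c : c <= 0 -> 0 <= c -> c = 0 by move=> c1 c2; apply/eqP; rewrite eq_le c1.
have [| | |h|h] := hirr [set x | mean_norm x = 0].
- split => /=.
  + by apply: mean_norm_null_eq0 => //; exact: mean_null0.
  + move=> x z hx hz; apply: lei; rewrite ?mean_norm_ge0 //.
    by have := mean_normD x z; rewrite hx hz addr0.
  + move=> a x hx; apply: lei; rewrite ?mean_norm_ge0 //.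
    by have := mean_normZ a x; rewrite hx mulr0.
  + by move=> x z hz /mean_norm_mono; rewrite hz => /lei; apply; exact: mean_norm_ge0.
- move=> x clx /=; apply: lei; rewrite ?mean_norm_ge0 //.
  apply/ler_addgt0Pr => e e0; rewrite add0r.
  have M1 : 0 < M + 1 by rewrite ltr_wpDl.
  have [z [/= hz]] := clx _ (nbhsx_ballx x _ (divr_gt0 e0 M1)).
  rewrite -ball_normE /= => hxz; have := mean_normD (x - z) z.
  rewrite subrK hz addr0 => /le_trans; apply; apply: (le_trans (mean_norm_le_norm _)).
  rewrite ltr_pdivlMr // in hxz; apply: le_trans (ltW hxz).
  by rewrite mulrC ler_wpM2l // lerDl.
- move=> t t0 _ [x /= hx <-]; apply: lei; rewrite ?mean_norm_ge0 //.
  by have := mean_norm_semigroup x t0; rewrite hx mulr0.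
- by move=> x hx; have : [set x | mean_norm x = 0] x by []; rewrite h.
- exfalso; apply: yn0; have : [set: E] y by []; rewrite -h /= => hy0.
  by apply/eqP; rewrite -normr_le0 -hy0 mean_norm_subinvariant.
Qed.
Lemma fixed_multiple t x : 0 <= t -> P t x = x -> forall n : nat, P (n%:R * t) x = x.
Proof.
move=> t0 h; elim=> [|n IH]; first by rewrite mul0r P_at0.
by rewrite -[n.+1%:R]natr1 mulrDl mul1r P_add ?mulr_ge0 // h.
Qed.

Lemma fixed2_multiple x : P 2 x = x -> forall n : nat, P (n%:R * 2) x = x.
Proof. exact: fixed_multiple. Qed.

Lemma exceed2 t : 0 <= t -> exists n : nat, 0 <= n%:R * 2 - t.
Proof. by move=> t0; exists (Num.bound t); have := archi_boundP t0; lra. Qed.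

(** * Rotating pairs *)

Section RotatingOrbit.
Hypothesis hE : order_continuous_norm E.
Variables a b : E.
Hypothesis Pa : forall t : R, 0 <= t -> P t a = cos (pi * t) *: a - sin (pi * t) *: b.

Lemma rotating_half_turn : P 1 a = - a.
Proof. by rewrite Pa // mulr1 cospi sinpi scale0r subr0 scaleN1r. Qed.

Lemma rotating_period : P 2 a = a.
Proof.
by rewrite (_ : 2 = 1 + 1) // P_add // rotating_half_turn linearN rotating_half_turn opprK.
Qed.

Lemma rotating_eq0 : a = 0 -> b = 0.
Proof.
move=> a0; have := Pa (t := 2^-1) _; rewrite a0 linear0 cos_pihalf sin_pihalf.
by rewrite scale0r scale1r sub0r invr_ge0 => /(_ (ler0n _ _))/esym/eqP; rewrite oppr_eq0 => /eqP.
Qed.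

Let orbit_le t : 0 <= t -> modulus (P t a) <=L modulus a + modulus b.
Proof.
move=> t0; rewrite Pa //; apply: (rle_trans (modulusB _ _)); rewrite !modulusZ.
have h c x : `|c| <= 1 -> `|c| *: modulus x <=L modulus x.
  by move=> hc; rewrite -[X in _ <=L X]scale1r; exact: rscale_le.
by apply: rleD; apply: h; rewrite ler_norml;
  [rewrite cos_geN1 cos_le1|rewrite sin_geN1 sin_le1].
Qed.

(** Since the orbit is periodic, [P t] maps it onto itself; so the supremum of its
moduli can only grow.  It plays the role of the modulus of the complex vector [a + i b]. *)
Lemma orbit_modulus : exists y, [/\ forall t, 0 <= t -> y <=L P t y,
  modulus a <=L y & y <=L modulus a + modulus b].
Proof.
pose D := [set modulus (P t a) | t in [set t : R | 0 <= t]].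
have [||y [y1 y2]] := @order_complete _ _ hE D (modulus a + modulus b).
- by exists (modulus (P 0 a)), 0 => //=.
- by move=> _ [t t0 <-]; exact: orbit_le.
exists y; split; last first.
- by apply: y2 => _ [t t0 <-]; exact: orbit_le.
- by apply: y1; exists 0; rewrite /= ?P_at0.
move=> s s0; apply: y2 => _ [t /= t0 <-].
have [n hn] := exceed2 s0.
have e : P t a = P s (P ((n%:R * 2 - s) + t) a).
  have -> : P s (P ((n%:R * 2 - s) + t) a) = P (s + ((n%:R * 2 - s) + t)) a.
    by rewrite P_add // addr_ge0.
  have -> : s + ((n%:R * 2 - s) + t) = n%:R * 2 + t by ring.
  by rewrite P_add ?mulr_ge0 // semigroup_comm ?mulr_ge0 // fixed2_multiple // rotating_period.
rewrite e; apply: (rle_trans (semigroup_modulus _ s0)); apply: semigroup_le => //.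
by apply: y1; exists ((n%:R * 2 - s) + t) => //=; rewrite addr_ge0.
Qed.

End RotatingOrbit.

(** * Lattice isomorphisms on periodic vectors, and sums of Rademacher elements *)

Section StrictSeminorm.
Hypothesis mean_norm_strict : forall x, mean_norm x = 0 -> x = 0.

(** For the asymptotic seminorm the semigroup preserves mass; so it cannot
increase an element strictly. *)
Lemma dyadic_fixed k (j : nat) x :
  x <=L P (j%:R / 2 ^+ k) x -> P (j%:R / 2 ^+ k) x = x.
Proof.
move=> /rsub_ge0 h; have := mean_norm_strict (mean_norm_null_eq0 h (mean_null_shift k j x)).
by move/eqP; rewrite subr_eq0 => /eqP.
Qed.

(** Being increased at every time and fixed at time 2 leaves no room for an
increase, also at times that are not dyadic. *)
Lemma subinvariant_fixed x : (forall t, 0 <= t -> x <=L P t x) ->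
  forall t, 0 <= t -> P t x = x.
Proof.
move=> h t t0; apply: rle_anti; last exact: h.
have h2 : P 2 x = x.
  have := @dyadic_fixed 0 2 x; rewrite expr0 divr1; apply; exact: h.
have [n hn] := exceed2 t0; have := fixed2_multiple h2 n => hx.
rewrite -[X in _ <=L X]hx; have -> : n%:R * 2 = t + (n%:R * 2 - t) by ring.
by rewrite P_add //; apply: semigroup_le => //; exact: h.
Qed.

(** On the vectors of period 2 the semigroup is a group of positive operators,
hence it acts by lattice isomorphisms. *)
Lemma periodic_modulus t u : P 2 u = u -> 0 <= t -> P t (modulus u) = modulus (P t u).
Proof.
have p2 v : P 2 v = v -> P 2 (modulus v) = modulus v.
  move=> hv; have := @dyadic_fixed 0 2 (modulus v); rewrite expr0 divr1; apply.
  by rewrite -{1}hv; exact: semigroup_modulus.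
move=> hu t0; apply: rle_anti; last exact: semigroup_modulus.
have [n hn] := exceed2 t0.
have hPu : P 2 (P t u) = P t u by rewrite semigroup_comm // hu.
have e : n%:R * 2 = (n%:R * 2 - t) + t by ring.
have h : modulus u <=L P (n%:R * 2 - t) (modulus (P t u)).
  by rewrite -{1}(fixed2_multiple hu n) {1}e P_add //; exact: semigroup_modulus.
have := semigroup_le t0 h.
by rewrite -P_add // addrC -e fixed2_multiple //; exact: p2.
Qed.

Lemma periodic_inf t u v : P 2 u = u -> P 2 v = v -> 0 <= t ->
  P t (riesz_inf u v) = riesz_inf (P t u) (P t v).
Proof.
move=> hu hv t0; have h : P 2 (u - v) = u - v by rewrite linearB /= hu hv.
rewrite !riesz_infE linearZ /=; congr (_ *: _).
by rewrite [LHS]linearB /= linearD /= periodic_modulus // linearB.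
Qed.

Lemma periodic_pospart t u : P 2 u = u -> 0 <= t ->
  P t (pospart u) = pospart (P t u).
Proof.
by move=> hu t0; rewrite !pospartE linearZ /= linearD /= periodic_modulus.
Qed.

(** The shift by [2 ^ - k] changes the sign of [x] and fixes the rest of the sum; it
does not change the seminorm; the average of both sums is then estimated through
[modulus_symmetric_mono].  This replaces the term [x] by a random sign times [y],
so that the sum is compared with a simple random walk. *)
Lemma mean_norm_flip k x y z : P (2 ^+ k)^-1 x = - x -> P (2 ^+ k)^-1 z = z ->
  modulus x <=L y -> P 2 (x + z) = x + z ->
  mean_norm (x + z) <= 2^-1 * mean_norm (z + y) + 2^-1 * mean_norm (z - y).
Proof.
move=> hx hz hxy h2; have t0 : 0 <= (2 ^+ k)^-1 :> R by rewrite invr_ge0 exprn_ge0.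
have h02 : 0 <= 2^-1 :> R by rewrite invr_ge0.
have hP : P (2 ^+ k)^-1 (modulus (x + z)) = modulus (z - x).
  by rewrite periodic_modulus // linearD hx hz addrC.
pose w := 2^-1 *: (modulus (x + z) - modulus (z - x)).
have nw : mean_null w.
  have -> : w = - 2^-1 *: (P (1%:R / 2 ^+ k) (modulus (x + z)) - modulus (x + z)).
    by rewrite mul1r hP /w; module_identity.
  by apply: mean_nullZ; exact: mean_null_shift.
apply: (@mean_norm_dominated (x + z) _ (z + y) _ (z - y) w) => //.
have := rleZ h02 (modulus_symmetric_mono z hxy) => h.
by apply: (rle_shift h); rewrite /w [z + x]addrC; module_identity.
Qed.

Lemma antiperiodic_double t x : 0 <= t -> P t x = - x -> P (2 * t) x = x.
Proof. by move=> t0 h; rewrite mulrDl mul1r P_add // h linearN h opprK. Qed.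

Lemma antiperiodic_period2 k x : P (2 ^+ k)^-1 x = - x -> P 2 x = x.
Proof.
have k0 : 0 <= (2 ^+ k)^-1 :> R by rewrite invr_ge0 exprn_ge0.
move=> /(antiperiodic_double k0) h.
have := fixed_multiple (mulr_ge0 (ler0n _ 2) k0) h (2 ^ k).
by rewrite natrX mulrCA mulfV ?mulr1 // expf_neq0.
Qed.

Section RademacherSums.
Variables (y : E) (r : nat -> E).
Hypothesis y_fixed : forall t, 0 <= t -> P t y = y.
Hypothesis r_modulus : forall k, modulus (r k) = y.
Hypothesis r_antiperiodic : forall k, P (2 ^+ k)^-1 (r k) = - r k.

Let pow_ge0 k : 0 <= (2 ^+ k)^-1 :> R.
Proof. by rewrite invr_ge0 exprn_ge0. Qed.

(** The shift that reverses [r l] fixes all later elements: it is a multiple of their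
periods. *)
Lemma rademacher_period k l : (l < k)%N -> P (2 ^+ l)^-1 (r k) = r k.
Proof.
move=> lk; have h := antiperiodic_double (pow_ge0 k) (r_antiperiodic k).
have := fixed_multiple (mulr_ge0 (ler0n _ 2) (pow_ge0 k)) h (2 ^ (k - l.+1)).
rewrite natrX; congr (P _ _ = _); rewrite mulrA -exprSr -subSn // subSS.
by rewrite -{2}(subnK (ltnW lk)) exprD invfM mulrA mulfV ?mul1r // expf_neq0.
Qed.

Lemma rademacher_period2 k : P 2 (r k) = r k.
Proof. exact: antiperiodic_period2 (r_antiperiodic k). Qed.

Lemma rademacher_sum_fixed t (s : seq nat) (c : nat -> R) d : 0 <= t ->
  {in s, forall k, P t (r k) = r k} ->
  P t (\sum_(k <- s) c k *: r k + d *: y) = \sum_(k <- s) c k *: r k + d *: y.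
Proof.
move=> t0 h; rewrite linearD linearZ /= y_fixed //; congr (_ + _).
by rewrite linear_sum; apply: eq_big_seq => k ks; rewrite linearZ /= h.
Qed.

(** The factor bounds the expected distance to the origin of a simple random walk
that starts at [d] and makes [size s] steps; [l] is free, and the choice
[l = sqrt (d ^ 2 + size s)] would be the best one. *)
Lemma rademacher_sum_bound (s : seq nat) (c : nat -> R) d l : 0 < l ->
  sorted ltn s -> (forall k, `|c k| <= 1) ->
  mean_norm (\sum_(k <- s) c k *: r k + d *: y) <=
  (d ^+ 2 + (size s)%:R + l ^+ 2) / (2 * l) * mean_norm y.
Proof.
move=> l0 ss hc; elim: s d ss => [|k s IH] d /= ss.
  rewrite big_nil add0r addr0; apply: (le_trans (mean_normZ _ _)).
  apply: ler_wpM2r; first exact: mean_norm_ge0.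
  rewrite ler_pdivlMr ?mulr_gt0 // -(real_normK (num_real d)) -subr_ge0.
  by have := sqr_ge0 (`|d| - l); rewrite sqrrB; lra.
have /allP lk : all (ltn k) s by move: ss; rewrite (path_sortedE ltn_trans) => /andP[].
have {}IH := fun d => IH d (path_sorted ss).
rewrite big_cons -addrA.
apply: le_trans (mean_norm_flip (k := k) (y := y) _ _ _ _) _.
- by rewrite linearZ /= r_antiperiodic scalerN.
- by apply: rademacher_sum_fixed => // i /lk; exact: rademacher_period.
- rewrite modulusZ r_modulus; have y0 : 0 <=L y by rewrite -(r_modulus 0).
  by have := rscale_le y0 (hc k); rewrite scale1r.
- have := @rademacher_sum_fixed 2 (k :: s) c d; rewrite big_cons -addrA; apply => //.
  by move=> i _; exact: rademacher_period2.
have -> : \sum_(i <- s) c i *: r i + d *: y + y = \sum_(i <- s) c i *: r i + (d + 1) *: y.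
  by module_identity.
have -> : \sum_(i <- s) c i *: r i + d *: y - y = \sum_(i <- s) c i *: r i + (d - 1) *: y.
  by module_identity.
have h2 : 0 <= 2^-1 :> R by rewrite invr_ge0.
apply: (le_trans (lerD (ler_wpM2l h2 (IH (d + 1))) (ler_wpM2l h2 (IH (d - 1))))).
rewrite le_eqVlt; apply/orP; left; apply/eqP.
by rewrite -[(size s).+1%:R]natr1; field; rewrite gt_eqF.
Qed.
End RademacherSums.

(** * Existence of Rademacher elements *)

Section RotatingPair.
Hypothesis hE : order_continuous_norm E.
Variables a b : E.
Hypothesis Pa : forall t : R, 0 <= t -> P t a = cos (pi * t) *: a - sin (pi * t) *: b.
Hypothesis ab_neq0 : ~ (a = 0 /\ b = 0).

Let P1a : P 1 a = - a.
Proof. exact: rotating_half_turn Pa. Qed.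

Let P2a : P 2 a = a.
Proof. exact: rotating_period Pa. Qed.

Let a_neq0 : a <> 0.
Proof. by move=> a0; apply: ab_neq0; split => //; exact: rotating_eq0 Pa a0. Qed.

Section Signs.
Variable y : E.
Hypothesis y_fixed : forall t, 0 <= t -> P t y = y.
Hypothesis a_le_y : modulus a <=L y.
Hypothesis y_le_ab : y <=L modulus a + modulus b.

Let y_ge0 : 0 <=L y.
Proof. exact: rle_trans (modulus_ge0 a) a_le_y. Qed.

(** Their supremum is the component of [y] in the band generated by [x]. *)
Let truncations x : set E := [set riesz_inf (n%:R *: x) y | n in setT].

Let truncations_ge0 x z : 0 <=L x -> truncations x z -> 0 <=L z.
Proof. by move=> x0 [n _ <-]; apply: rle_inf => //; exact: rscale_ge0. Qed.

Let truncations_neq0 x : truncations x !=set0.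
Proof. by exists (riesz_inf (0%:R *: x) y), 0%N. Qed.

Lemma component_exists x : exists e : E, is_lub (truncations x) e.
Proof.
by apply: (@order_complete _ _ hE _ y) => // _ [n _ <-]; exact: rinf_le_r.
Qed.

(** What is left of [y] outside its component is disjoint from [x]: the common part
could be added to the truncations of [x], which would then exceed [e]. *)
Lemma component_residue x (e : E) z : 0 <=L x -> is_lub (truncations x) e ->
  z <=L y - e -> 0 <=L z -> riesz_inf z x = 0.
Proof.
move=> x0 [e1 e2] ze z0; apply: rle_anti; last exact: rle_inf.
set w := riesz_inf z x; have wz : w <=L z by exact: rinf_le_l.
have wx : w <=L x by exact: rinf_le_r.
suff : e <=L e - w by move=> h; apply: (rle_shift h); module_identity.
apply: e2 => _ [n _ <-].
have : riesz_inf (n%:R *: x) y + w <=L riesz_inf (n.+1%:R *: x) y.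
  apply: rle_inf.
    by rewrite -[n.+1%:R]natr1 scalerDl scale1r; apply: rleD => //; exact: rinf_le_l.
  have h : riesz_inf (n%:R *: x) y <=L e by apply: e1; exists n.
  by apply: (rle_shift (rleD (rleD h wz) ze)); module_identity.
move=> h; have h2 : riesz_inf (n.+1%:R *: x) y <=L e by apply: e1; exists n.+1.
by apply: (rle_shift (rle_trans h h2)); module_identity.
Qed.

Lemma component_half_turn x (e e' : E) : P 2 x = x -> P 1 x = - x ->
  is_lub (truncations (pospart x)) e -> is_lub (truncations (pospart (- x))) e' ->
  e' <=L P 1 e.
Proof.
move=> hx hx1 [e1 _] [_]; apply => _ [n _ <-].
have hp : P 2 (pospart x) = pospart x by rewrite periodic_pospart // hx.
have -> : riesz_inf (n%:R *: pospart (- x)) y = P 1 (riesz_inf (n%:R *: pospart x) y).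
  rewrite periodic_inf // ?y_fixed // linearZ /=; last by rewrite hp.
  by rewrite periodic_pospart // hx1.
by apply: semigroup_le => //; apply: e1; exists n.
Qed.

(** In the function model [d] lives on the zeros of [cos theta].  Its rotations
through different angles are therefore disjoint and have a sum below [y].  They all
count equally in the seminorm, and there are infinitely many. *)
Lemma residue_eq0 d : 0 <=L d -> d <=L y -> P 2 d = d -> riesz_inf d (modulus a) = 0 ->
  d = 0.
Proof.
move=> d0 dy d2 da; apply: mean_norm_strict.
have tge m (i : nat) : 0 <= i%:R / 2 ^+ m :> R by rewrite divr_ge0 // exprn_ge0.
pose e m i := P (i%:R / 2 ^+ m) d.
have ege m i : 0 <=L e m i by exact: P_pos.
have ey m i : e m i <=L y by rewrite -(y_fixed (tge m i)); exact: semigroup_le.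
have dis m i j : (i < j < 2 ^ m)%N -> riesz_inf (e m i) (e m j) = 0.
  move=> /andP[ij jm]; set w := riesz_inf _ _.
  have w0 : 0 <=L w by exact: rle_inf.
  have rot k : e m k = e m i \/ e m k = e m j ->
      riesz_inf w (modulus (P (k%:R / 2 ^+ m) a)) = 0.
    move=> hk; have hek : riesz_inf (e m k) (modulus (P (k%:R / 2 ^+ m) a)) = 0.
      rewrite -periodic_modulus // -periodic_inf ?da ?linear0 //.
      by rewrite periodic_modulus // P2a.
    apply: (disjoint_mono _ _ _ _ hek) => //.
    by case: hk => ->; [exact: rinf_le_l|exact: rinf_le_r].
  set u := P (i%:R / 2 ^+ m) a; set v := P (j%:R / 2 ^+ m) a.
  have wu : riesz_inf w (modulus u) = 0 by apply: rot; left.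
  have wv : riesz_inf w (modulus v) = 0 by apply: rot; right.
  pose si : R := sin (pi * (i%:R / 2 ^+ m)); pose ci : R := cos (pi * (i%:R / 2 ^+ m)).
  pose sj : R := sin (pi * (j%:R / 2 ^+ m)); pose cj : R := cos (pi * (j%:R / 2 ^+ m)).
  have hu : u = ci *: a - si *: b by rewrite /u Pa.
  have hv : v = cj *: a - sj *: b by rewrite /v Pa.
  pose g := sj * ci - cj * si.
  have g0 : 0 < g.
    have -> : g = sin (pi * ((j%:R - i%:R) / 2 ^+ m)).
      by rewrite mulrBl mulrBr sinB.
    apply: sin_gt0_pi; apply/andP; split.
      by rewrite mulr_gt0 ?pi_gt0 // divr_gt0 ?exprn_gt0 // subr_gt0 ltr_nat.
    rewrite -[X in _ < X]mulr1 ltr_pM2l ?pi_gt0 // ltr_pdivrMr ?exprn_gt0 // mul1r.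
    apply: le_lt_trans (_ : j%:R < _); first by rewrite gerBl.
    by rewrite -natrX ltr_nat.
  have comb p q x : g *: x = p *: u + q *: v -> riesz_inf w (modulus x) = 0.
    move=> hx; have gm : modulus x = g^-1 *: modulus (g *: x).
      by rewrite modulusZ (gtr0_norm g0) scalerA mulVf ?gt_eqF // scale1r.
    rewrite gm; apply: disjointZ => //; first by rewrite invr_ge0 ltW.
    rewrite hx; apply: (@disjoint_mono _ _ w w _ (`|p| *: modulus u + `|q| *: modulus v)) => //.
      by apply: (rle_trans (modulusD _ _)); rewrite !modulusZ.
    by apply: disjointD; rewrite ?disjointZ //; exact: rscale_ge0.
  have wa : riesz_inf w (modulus a) = 0.
    by apply: (comb sj (- si)); rewrite hu hv /g; module_identity.
  have wb : riesz_inf w (modulus b) = 0.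
    by apply: (comb cj (- ci)); rewrite hu hv /g; module_identity.
  have := disjointD w0 (modulus_ge0 a) (modulus_ge0 b) wa wb.
  move=> h; apply: rle_anti => //; rewrite -h; apply: rle_inf => //.
  by apply: rle_trans y_le_ab; exact: rle_trans (rinf_le_l _ _) (ey _ _).
have nul m n : mean_null (n%:R *: d - \sum_(i < n) e m i).
  elim: n => [|n IH]; first by rewrite scale0r big_ord0 subr0; exact: mean_null0.
  have -> : n.+1%:R *: d - \sum_(i < n.+1) e m i =
      (n%:R *: d - \sum_(i < n) e m i) + (-1) *: (e m n - d).
    by rewrite big_ord_recr /= -[n.+1%:R]natr1; module_identity.
  by apply: mean_nullD => //; apply: mean_nullZ; exact: mean_null_shift.
have bound m : 2 ^+ m * mean_norm d <= mean_norm y.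
  apply: (le_trans (mean_norm_scale_ge _ _)); first exact: exprn_ge0.
  have s0 n : 0 <=L \sum_(i < n) e m i.
    by elim/big_ind : _ => // *; exact: raddr_ge0.
  apply: le_trans (_ : mean_norm (\sum_(i < 2 ^ m) e m i) <= _).
    apply: mean_norm_le_of_null => //; first by apply: rscale_ge0 => //; exact: exprn_ge0.
    by have := nul m (2 ^ m)%N; rewrite natrX.
  apply: mean_norm_mono; rewrite !ger0_modulus //; apply: disjoint_sum_le => //.
  exact: dis.
apply/eqP; rewrite eq_le mean_norm_ge0 andbT leNgt; apply/negP => p0.
have [m hm] := archi_pow2 (mean_norm y / mean_norm d).
by have := bound m; rewrite leNgt -ltr_pdivrMr // hm.
Qed.

(** The sign of [a] relative to [y] is the difference of the components of [y] that
belong to the positive and to the negative part of [a], which [P 1] exchanges. *)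
Lemma first_rademacher : exists r, modulus r = y /\ P 1 r = - r.
Proof.
have [e he] := component_exists (pospart a).
have [f hf] := component_exists (pospart (- a)).
have a2 := P2a; have Na1 : P 1 (- a) = - - a by rewrite linearN P1a.
have fe := component_half_turn a2 P1a he hf.
have ef : e <=L P 1 f.
  apply: (component_half_turn _ Na1 hf); first by rewrite linearN P2a.
  by rewrite opprK.
have lub_ge0 x z : 0 <=L x -> is_lub (truncations x) z -> 0 <=L z.
  move=> x0 [z1 _]; have h : truncations x (riesz_inf (0%:R *: x) y) by exists 0%N.
  exact: rle_trans (truncations_ge0 x0 h) (z1 _ h).
have e0 := lub_ge0 _ _ (pospart_ge0 a) he.
have f0 := lub_ge0 _ _ (pospart_ge0 (- a)) hf.
have ey : e <=L y by apply: he.2 => _ [n _ <-]; exact: rinf_le_r.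
have fy : f <=L y by apply: hf.2 => _ [n _ <-]; exact: rinf_le_r.
have ef0 : riesz_inf e f = 0.
  apply: (inf_lub_eq0 he (truncations_neq0 _)) => // [z|z hz]; first exact: truncations_ge0.
  rewrite rinfC; apply: (inf_lub_eq0 hf (truncations_neq0 _)) => [w||w [n _ <-]].
  - exact: truncations_ge0.
  - exact: truncations_ge0 hz.
  case: hz => m _ <-.
  have := disjointZ (pospart_ge0 _) (pospart_ge0 _) (ler0n R n) (pospart_inf a).
  rewrite rinfC => h1.
  have h2 := disjointZ (rscale_ge0 (ler0n R n) (pospart_ge0 _)) (pospart_ge0 _) (ler0n R m) h1.
  apply: (disjoint_mono _ _ _ _ h2); try exact: rinf_le_l.
    by apply: rle_inf => //; exact: rscale_ge0.
  by apply: rle_inf => //; exact: rscale_ge0.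
have sumE : e + f = riesz_sup e f by rewrite -rsup_add_inf ef0 addr0.
have sum_le : e + f <=L y by rewrite sumE; exact: rsup_le.
have sum1 : P 1 (e + f) = e + f.
  have := @dyadic_fixed 0 1 (e + f); rewrite expr0 divr1; apply.
  by rewrite linearD addrC; exact: rleD.
have P1e : P 1 e = f.
  apply: rle_anti => //; apply: (rle_shift ef).
  have h : P 1 e + P 1 f = e + f by rewrite -linearD.
  have -> : P 1 f = e + f - P 1 e by rewrite -h; module_identity.
  module_identity.
have P1f : P 1 f = e.
  by have := sum1; rewrite linearD /= P1e addrC => /addIr.
have res : y - (e + f) = 0.
  apply: residue_eq0.
  - exact/rsub_ge0.
  - by apply: (rle_shift (raddr_ge0 e0 f0)); module_identity.
  - rewrite linearB /= y_fixed // (_ : 2 = 1 + 1) // P_add //.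
    by rewrite sum1 sum1.
  - rewrite -pospart_add; apply: disjointD => //; first exact/rsub_ge0.
    + apply: (component_residue _ he) => //; last exact/rsub_ge0.
      by apply: (rle_shift f0); module_identity.
    + apply: (component_residue _ hf) => //; last exact/rsub_ge0.
      by apply: (rle_shift e0); module_identity.
exists (e - f); split.
  rewrite modulus_sub_inf //.
  by move/eqP: res; rewrite subr_eq0 => /eqP.
by rewrite linearB /= P1e P1f opprB.
Qed.

(** Shifting by half the antiperiod turns [(r, s)] into [(s, - r)], which changes the
sign of the product of [r] and [s]. *)
Lemma next_rademacher k r : modulus r = y -> P (2 ^+ k)^-1 r = - r ->
  exists q, modulus q = y /\ P (2 ^+ k.+1)^-1 q = - q.
Proof.
move=> hr hP; have t0 : 0 <= (2 ^+ k.+1)^-1 :> R by rewrite invr_ge0 exprn_ge0.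
set t := (2 ^+ k.+1)^-1 in t0 *; set s := P t r.
have tt : t + t = (2 ^+ k)^-1 by rewrite /t exprS; field; rewrite expf_neq0.
have hs : P t s = - r by rewrite -P_add // tt.
have r2 : P 2 r = r := antiperiodic_period2 hP.
have s2 : P 2 s = s by rewrite semigroup_comm // r2.
exists (2^-1 *: (modulus (r + s) - modulus (r - s))); split.
  apply: modulus_signed_product => //.
  by rewrite -periodic_modulus // hr y_fixed.
have h1 : P 2 (r + s) = r + s by rewrite linearD /= r2 s2.
have h2 : P 2 (r - s) = r - s by rewrite linearB /= r2 s2.
have e1 : P t (modulus (r + s)) = modulus (r - s).
  by rewrite periodic_modulus // linearD /= hs -/s -modulusN opprD opprK addrC.
have e2 : P t (modulus (r - s)) = modulus (r + s).
  by rewrite periodic_modulus // linearB /= hs -/s opprK addrC.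
rewrite linearZ /= linearB /= e1 e2; module_identity.
Qed.

End Signs.

Lemma rademacher_exist : exists y (r : nat -> E), [/\ y <> 0,
  forall t, 0 <= t -> P t y = y, forall k, modulus (r k) = y &
  forall k, P (2 ^+ k)^-1 (r k) = - r k].
Proof.
have [y [yle ya yab]] := orbit_modulus hE Pa.
have yP := subinvariant_fixed yle.
pose good k q := modulus q = y /\ P (2 ^+ k)^-1 q = - q.
have [r0 hr0] : exists r, good 0 r.
  have [r [h1 h2]] := first_rademacher yP ya yab.
  by exists r; split => //; rewrite expr0 invr1.
have /choice[f hf] : forall kq : nat * E, exists q', good kq.1 kq.2 -> good kq.1.+1 q'.
  move=> [k q]; case: (pselect (good k q)) => [[h1 h2]|h]; last by exists q.
  by have [q' hq'] := next_rademacher yP h1 h2; exists q'.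
pose r := fix r k := match k with 0 => r0 | k'.+1 => f (k', r k') end.
have hr k : good k (r k) by elim: k => [//|k IH]; exact: (hf (k, r k)).
exists y, r; split => // [y0|k|k]; last 2 first.
- by case: (hr k).
- by case: (hr k).
apply/a_neq0/modulus_eq0/rle_anti => //.
by rewrite -y0.
Qed.

End RotatingPair.

(** * Operators below the semigroup *)

Section DominatedOperators.
Variables (t0 : R) (K : {linear E -> E}).
Hypothesis t0_ge0 : 0 <= t0.
Hypothesis K_pos : positive_op K.
Hypothesis K_le : op_le K (P t0).

Lemma positive_op_le x z : x <=L z -> K x <=L K z.
Proof. by move=> /rsub_ge0/K_pos; rewrite linearB => /rsub_ge0. Qed.

Lemma positive_op_modulus x : modulus (K x) <=L K (modulus x).
Proof.
apply: modulus_le; first exact/positive_op_le/rle_modulus.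
by rewrite -linearN; exact/positive_op_le/rleN_modulus.
Qed.

Lemma dominated_norm x : `|K x| <= M * `|x|.
Proof.
rewrite -(norm_modulus x); apply: le_trans (P_bounded t0_ge0 _).
apply: modulus_le_norm; apply: (rle_trans (positive_op_modulus _)); exact: K_le.
Qed.

Lemma dominated_mean_norm x : mean_norm (K x) <= M * mean_norm x.
Proof.
apply: le_trans (_ : mean_norm (P t0 (modulus x)) <= _).
  apply: mean_norm_mono; apply: rle_trans (rle_modulus _).
  by apply: (rle_trans (positive_op_modulus _)); exact: K_le.
by rewrite -(mean_norm_modulus x) mean_norm_semigroup.
Qed.

(** An operator below a lattice homomorphism is a lattice homomorphism, since the
triangle inequality for the decomposition [P t0 = K + (P t0 - K)] is an equality. *)
Lemma dominated_modulus x : P 2 x = x -> modulus (K x) = K (modulus x).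
Proof.
move=> hx; apply: rle_anti; first exact: positive_op_modulus.
have h : modulus (P t0 x - K x) <=L P t0 (modulus x) - K (modulus x).
  have g z : 0 <=L z -> K z <=L P t0 z by exact: K_le.
  apply: modulus_le.
    have /g : 0 <=L modulus x - x by apply/rsub_ge0; exact: rle_modulus.
    rewrite (linearB K) (linearB (P t0)) /= => hg.
    by apply: (rle_shift hg); module_identity.
  have /g : 0 <=L modulus x + x.
    by apply: (rle_shift (rleN_modulus x)); module_identity.
  rewrite (linearD K) (linearD (P t0)) /= => hg.
  by apply: (rle_shift hg); module_identity.
have := modulusD (K x) (P t0 x - K x).
rewrite addrC subrK -periodic_modulus // => h2.
by apply: (rle_shift (rle_trans h2 (rleD (rle_refl _) h))); module_identity.
Qed.

(** The vectors annihilated by all [K P(t)] in modulus form an invariant closed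
ideal. *)
Lemma dominated_fixed_eq0 (hirr : irreducible_semigroup P) y : y <> 0 -> 0 <=L y ->
  (forall t, 0 <= t -> P t y = y) -> K y = 0 -> forall x, K x = 0.
Proof.
move=> yn0 y0 yP Ky.
pose J := [set x | forall t, 0 <= t -> K (P t (modulus x)) = 0].
have sandwich x z : 0 <=L x -> x <=L z -> K z = 0 -> K x = 0.
  move=> x0 xz hz; apply: rle_anti; last exact: K_pos.
  by rewrite -hz; exact: positive_op_le.
have [| | |h|h] := hirr J.
- split.
  + by move=> t ht; rewrite modulus0 !linear0.
  + move=> x z hx hz t ht; apply: (sandwich _ (P t (modulus x) + P t (modulus z))).
    * exact: P_pos.
    * by rewrite -linearD; apply: semigroup_le => //; exact: modulusD.
    * by rewrite linearD /= hx // hz // addr0.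
  + by move=> a x hx t ht; rewrite modulusZ !linearZ /= hx // scaler0.
  + move=> x z hz hxz t ht; apply: (sandwich _ (P t (modulus z))); last exact: hz.
      exact: P_pos.
    exact: semigroup_le.
- move=> x clx t ht; apply: norm_arbitrarily_small => e e0.
  have M1 : 0 < M * M + 1 by rewrite ltr_wpDl ?mulr_ge0.
  have [z [/= hz]] := clx _ (nbhsx_ballx x _ (divr_gt0 e0 M1)).
  rewrite -ball_normE /= => hxz.
  have -> : K (P t (modulus x)) = K (P t (modulus x - modulus z)).
    by rewrite !linearB /= (hz _ ht) subr0.
  apply: (le_trans (dominated_norm _)).
  apply: (le_trans (ler_wpM2l M_ge0 (P_bounded ht _))).
  have hxz' : `|modulus x - modulus z| <= `|x - z|.
    by apply: lattice_norm; exact: modulus_dist.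
  rewrite ltr_pdivlMr // in hxz; apply: le_trans (ltW hxz).
  rewrite mulrA; apply: (le_trans (ler_wpM2l _ hxz')); first exact: mulr_ge0.
  by rewrite mulrDr mulr1 mulrC lerDl.
- move=> t ht _ [x /= hx <-] s hs.
  apply: (sandwich _ (P (s + t) (modulus x))); last by apply: hx; rewrite addr_ge0.
    exact: P_pos.
  by rewrite P_add //; apply: semigroup_le => //; exact: semigroup_modulus.
- exfalso; apply: yn0; suff : J y by rewrite h.
  by move=> t ht; rewrite ger0_modulus // yP.
- move=> x; apply/modulus_eq0/rle_anti => //.
  apply: (rle_trans (positive_op_modulus _)).
  have : J x by rewrite h.
  by move=> /(_ 0 (lexx _)); rewrite P_at0 => ->.
Qed.

Section AgainstRademacher.
Hypothesis hE : order_continuous_norm E.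
Variables (y : E) (r : nat -> E).
Hypothesis y_fixed : forall t, 0 <= t -> P t y = y.
Hypothesis r_modulus : forall k, modulus (r k) = y.
Hypothesis r_antiperiodic : forall k, P (2 ^+ k)^-1 (r k) = - r k.

Let image_modulus k : modulus (K (r k)) = K y.
Proof. by rewrite dominated_modulus ?r_modulus //; exact: rademacher_period2 r_antiperiodic k. Qed.

Let y_ge0 : 0 <=L y.
Proof. by rewrite -(r_modulus 0). Qed.

(** With [m.+1 ^ 2] terms, the choice [l = m.+1] gives the factor [m.+1]. *)
Let rademacher_square_sum (m : nat) (s : seq nat) (c : nat -> R) :
  sorted ltn s -> size s = (m.+1 * m.+1)%N -> (forall k, `|c k| <= 1) ->
  mean_norm (\sum_(k <- s) c k *: r k) <= m.+1%:R * mean_norm y.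
Proof.
move=> ss hs hc.
have := @rademacher_sum_bound y r y_fixed r_modulus r_antiperiodic s c 0 m.+1%:R
  (ltr0Sn _ _) ss hc.
rewrite scale0r addr0 hs natrM; suff -> : forall l : R, l != 0 ->
  (0 ^+ 2 + l * l + l ^+ 2) / (2 * l) = l by [].
by move=> l l0; field.
Qed.

(** A cluster point [w] of the images is near the mean of arbitrarily many of them.
These means tend to zero in the seminorm, hence [w = 0]; but all images have the
same modulus. *)
Lemma compact_dominated_eq0 : compact_op K -> K y = 0.
Proof.
move=> cK; case: (pselect (y = 0)) => [->|yn0]; first exact: linear0.
have ny : 0 < `|y| by rewrite normr_gt0; apply/eqP.
pose x k := K (`|y|^-1 *: r k).
have xball : (x @ \oo) (closure (K @` [set x : E | `|x| <= 1])).
  exists 0%N => // k _; apply: subset_closure; exists (`|y|^-1 *: r k) => //=.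
  by rewrite normrZ gtr0_norm ?invr_gt0 // -(norm_modulus (r k)) r_modulus mulVf ?gt_eqF.
have := cK; rewrite /compact_op precompactE => /(_ _ _ xball)[w [_ clw]].
have {clw} freq (e : R) n : 0 < e -> exists2 k, (n < k)%N & `|w - x k| < e.
  move=> e0; have xn : (x @ \oo) [set z | exists2 k, (n < k)%N & z = x k].
    by exists n.+1 => // k nk; exists k.
  have [z [[k nk ->]]] := clw _ _ xn (nbhsx_ballx w _ e0).
  by rewrite -ball_normE /= => h; exists k.
have sel (e : R) (N n : nat) : 0 < e ->
    exists s : seq nat, [/\ size s = N, path ltn n s & {in s, forall k, `|w - x k| < e}].
  move=> e0; elim: N n => [|N IH] n; first by exists [::].
  have [k nk hk] := freq _ n e0; have [s [s1 s2 s3]] := IH k.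
  exists (k :: s); split; rewrite /= ?s1 ?nk //.
  by move=> i; rewrite inE => /orP[/eqP->|/s3].
suff w0 : w = 0.
  apply: norm_arbitrarily_small => e e0.
  have [k _] := freq _ 0%N (divr_gt0 e0 ny).
  rewrite w0 sub0r normrN /x linearZ /= normrZ gtr0_norm ?invr_gt0 //.
  by rewrite -(norm_modulus (K (r k))) image_modulus mulrC ltr_pM2r ?invr_gt0 // => /ltW.
apply: mean_norm_strict; apply/eqP; rewrite eq_le mean_norm_ge0 andbT.
apply/ler_addgt0Pr => e e0; rewrite add0r.
have M1 : 0 < M + 1 by rewrite ltr_wpDl.
pose d := e / 2 / (M + 1); have d0 : 0 < d by rewrite !divr_gt0.
pose C := M * (`|y|^-1 * mean_norm y).
have C0 : 0 <= C by rewrite !mulr_ge0 ?invr_ge0 ?mean_norm_ge0.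
pose m := Num.bound (C / (e / 2)).
have hm : C <= e / 2 * m.+1%:R.
  rewrite mulrC -ler_pdivrMr ?divr_gt0 //.
  apply: le_trans (ltW (archi_boundP _)) _; first by rewrite divr_ge0 // ltW // divr_gt0.
  by rewrite ler_nat.
have [s [s1 s2 s3]] := sel _ (m.+1 * m.+1)%N 0%N d0.
set N := (m.+1 * m.+1)%N in s1.
have dec : N%:R *: w = K (`|y|^-1 *: \sum_(k <- s) 1 *: r k) + \sum_(k <- s) (w - x k).
  rewrite sumrB big_const_seq count_predT s1 iter_addr_0 scaler_nat.
  have -> : \sum_(k <- s) x k = K (`|y|^-1 *: \sum_(k <- s) 1 *: r k).
    rewrite scaler_sumr linear_sum; apply: eq_bigr => k _.
    by rewrite scale1r.
  by rewrite addrC subrK.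
have e1 : mean_norm (\sum_(k <- s) (w - x k)) <= N%:R * (e / 2).
  rewrite -s1; elim: (s) s3 => [_|k s' IH s3].
    by rewrite big_nil mul0r mean_norm_null_eq0 //; exact: mean_null0.
  rewrite big_cons /= -[(size s').+1%:R]natr1 mulrDl mul1r [X in _ <= X]addrC.
  apply: (le_trans (mean_normD _ _)); apply: lerD; last first.
    by apply: IH => i si; apply: s3; rewrite inE si orbT.
  apply: (le_trans (mean_norm_le_norm _)).
  have /s3/ltW h : k \in k :: s' by rewrite inE eqxx.
  apply: (le_trans (ler_wpM2l M_ge0 h)).
  by rewrite /d mulrCA; apply: ler_piMr; rewrite ?ler_pdivrMr ?mul1r ?lerDl // ltW // divr_gt0.
have e2 : mean_norm (K (`|y|^-1 *: \sum_(k <- s) 1 *: r k)) <= C * m.+1%:R.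
  apply: (le_trans (dominated_mean_norm _)); rewrite /C -mulrA; apply: ler_wpM2l => //.
  apply: (le_trans (mean_normZ _ _)).
  rewrite (gtr0_norm (_ : 0 < `|y|^-1)) ?invr_gt0 // -mulrA; apply: ler_wpM2l.
    by rewrite invr_ge0.
  rewrite mulrC; apply: (rademacher_square_sum (c := fun=> 1)) => //.
    exact: path_sorted s2.
  by move=> k; rewrite normr1.
have N0 : 0 < N%:R :> R by rewrite ltr0n.
rewrite -(ler_pM2l N0).
apply: le_trans (mean_norm_scale_ge _ (ltW N0)) _; rewrite dec.
apply: (le_trans (mean_normD _ _)); apply: (le_trans (lerD e2 e1)).
have h : C * m.+1%:R <= e / 2 * m.+1%:R * m.+1%:R by apply: ler_wpM2r.
have -> : N%:R * e = e / 2 * m.+1%:R * m.+1%:R + N%:R * (e / 2).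
  by rewrite /N natrM; field.
by rewrite lerD2r.
Qed.

(** The seminorm of [x] controls the norm of [x] as long as [x] stays in an order
interval.  Otherwise there would be elements [x m] with summable seminorms, whose
suprema over the tails decrease to zero in order, but not in norm. *)
Lemma mean_norm_absolutely_continuous (d : R) : 0 < d -> exists2 h : R, 0 < h &
  forall x, modulus x <=L y -> mean_norm x < h -> `|x| < d.
Proof.
move=> d0; apply: contrapT => hno.
have bad (m : nat) : exists x, [/\ modulus x <=L y, mean_norm x < 2^-1 ^+ m & d <= `|x|].
  apply: contrapT => hm; apply: hno; exists (2^-1 ^+ m); first by rewrite exprn_gt0.
  move=> x hx hp; rewrite ltNge; apply/negP => hd; apply: hm; by exists x.
have /choice[x hx] := bad.
pose g m := fix g n := match n with
  0 => modulus (x m) | n'.+1 => riesz_sup (g n') (modulus (x (m + n'.+1)%N)) end.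
have g_ge m i n : (i <= n)%N -> modulus (x (m + i)%N) <=L g m n.
  elim: n => [|n IH]; first by rewrite leqn0 => /eqP->; rewrite addn0.
  rewrite leq_eqVlt => /predU1P[->|/IH h]; first exact: rlesup_r.
  exact: rle_trans h (rlesup_l _ _).
have g_le m z n : (forall i, modulus (x (m + i)%N) <=L z) -> g m n <=L z.
  move=> hz; elim: n => [|n IH]; first by have := hz 0%N; rewrite addn0.
  exact: rsup_le.
have g0 m n : 0 <=L g m n by apply: rle_trans (g_ge m 0%N n _).
have g_norm m n : mean_norm (g m n) <= 2 * 2^-1 ^+ m - 2^-1 ^+ (m + n).
  elim: n => [|n IH].
    by rewrite addn0 mean_norm_modulus; have [_ /ltW h _] := hx m; lra.
  apply: le_trans (_ : mean_norm (g m n) + mean_norm (x (m + n.+1)%N) <= _).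
    rewrite -(mean_norm_modulus (x _)); apply: le_trans (mean_normD _ _).
    apply: mean_norm_mono; rewrite (ger0_modulus (g0 m n.+1)).
    rewrite (ger0_modulus (raddr_ge0 (g0 m n) (modulus_ge0 _))).
    apply: rsup_le.
      by apply: (rle_shift (modulus_ge0 (x (m + n.+1)%N))); module_identity.
    by apply: (rle_shift (g0 m n)); module_identity.
  have [_ /ltW h _] := hx (m + n.+1)%N.
  by move: h IH; rewrite addnS exprS; lra.
have tail m : exists s : E, [/\ forall i, modulus (x (m + i)%N) <=L s,
    forall z, (forall i, modulus (x (m + i)%N) <=L z) -> s <=L z &
    mean_norm s <= 2 * 2^-1 ^+ m].
  have [|||s [s1 s2] s3] := @directed_lub _ _ hE (range (g m)) y.
  - by exists (g m 0%N), 0%N.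
  - move=> _ _ [i _ <-] [j _ <-]; exists (g m (maxn i j)).
    have mono p q : (p <= q)%N -> g m p <=L g m q.
      elim: q => [|q IH]; first by rewrite leqn0 => /eqP->.
      rewrite leq_eqVlt => /predU1P[-> //|/IH h].
      exact: rle_trans h (rlesup_l _ _).
    by split; [exists (maxn i j)|apply: mono; rewrite leq_maxl|apply: mono; rewrite leq_maxr].
  - by move=> _ [n _ <-]; apply: g_le => i; have [] := hx (m + i)%N.
  exists s; split.
  - by move=> i; apply: (rle_trans (g_ge m i i _)) => //; apply: s1; exists i.
  - by move=> z hz; apply: s2 => _ [n _ <-]; exact: g_le.
  apply/ler_addgt0Pr => e e0.
  have M1 : 0 < M + 1 by rewrite ltr_wpDl.
  have [_ [n _ <-] /ltW hn] := s3 _ (divr_gt0 e0 M1).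
  have := mean_normD (s - g m n) (g m n); rewrite subrK => /le_trans; apply.
  rewrite addrC; apply: lerD.
    apply: (le_trans (g_norm _ _)); rewrite gerBl exprn_ge0 //.
  apply: (le_trans (mean_norm_le_norm _)); apply: (le_trans (ler_wpM2l M_ge0 hn)).
  by rewrite mulrCA; apply: ler_piMr; rewrite ?ler_pdivrMr ?mul1r ?lerDl // ltW.
have /choice[s hs] := tail.
have s0 m : 0 <=L s m.
  by have [h _ _] := hs m; apply: rle_trans (h 0%N).
have s_anti m n : (m <= n)%N -> s n <=L s m.
  move=> mn; have [_ h _] := hs n; apply: h => i; have [h _ _] := hs m.
  by rewrite -(subnKC mn) -addnA; exact: h.
have dirS : downward_directed (range s).
  split; first by exists (s 0%N), 0%N.
  move=> _ _ [m _ <-] [n _ <-]; exists (s (maxn m n)).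
  by split; [exists (maxn m n)|apply: s_anti; rewrite leq_maxl|apply: s_anti; rewrite leq_maxr].
have infS : is_inf (range s) 0.
  split; first by move=> _ [m _ <-].
  move=> b hb; suff <- : pospart b = 0 by exact: rlesup_l.
  apply: mean_norm_strict; apply/eqP; rewrite eq_le mean_norm_ge0 andbT leNgt.
  apply/negP => p0; have [m hm] := archi_pow2 (2 / mean_norm (pospart b)).
  have [_ _ h] := hs m.
  have hb' : pospart b <=L s m by apply: rsup_le => //; apply: hb; exists m.
  have : mean_norm (pospart b) <= 2 * 2^-1 ^+ m.
    by apply: le_trans h; apply: mean_norm_mono; rewrite !ger0_modulus.
  rewrite exprVn leNgt ltr_pdivrMr ?exprn_gt0 //.
  by move: hm; rewrite ltr_pdivrMr // mulrC => ->.
have [_ [m _ <-] hm] := hE dirS infS d0.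
have := hm (s m) _ (rle_refl _); have [h1 _ _] := hs m; have [_ _ h2] := hx m.
rewrite ltNge => /(_ _)/negP; apply; first by exists m.
apply: (le_trans h2); apply: modulus_le_norm.
by have := h1 0%N; rewrite addn0.
Qed.

(** [K] acts like an integral operator with a bounded kernel: the sum of the
[modulus (K (r k))] is controlled by the largest signed sum of the [r k], which
is of smaller order than the number of terms. *)
Lemma norm_dominated_eq0 u : 0 <=L u ->
  (forall x, 0 <=L x -> K x <=L `|x| *: u) -> K y = 0.
Proof.
move=> u0 hKu; apply: rle_anti; last exact: K_pos.
apply: rle0_approx => e e0.
pose d := e / (`|u| + 1).
have u1 : 0 < `|u| + 1 by rewrite ltr_wpDl.
have d0 : 0 < d by rewrite divr_gt0.
have [h h0 hh] := mean_norm_absolutely_continuous d0.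
pose m := Num.bound (mean_norm y / h).
have hm : mean_norm y < h * m.+1%:R.
  rewrite mulrC -ltr_pdivrMr //; apply: lt_le_trans (archi_boundP _) _.
    by rewrite divr_ge0 ?mean_norm_ge0 // ltW.
  by rewrite ler_nat.
pose N := (m.+1 * m.+1)%N; have N0 : 0 < N%:R :> R by rewrite ltr0n.
pose s := iota 0 N.
have ss : sorted ltn s by exact: iota_ltn_sorted.
have y0 := y_ge0.
have bound (c : nat -> R) : (forall k, `|c k| = 1) ->
    \sum_(k <- s) c k *: K (r k) <=L (N%:R * d) *: u.
  move=> hc; pose S := \sum_(k <- s) c k *: r k.
  have hc1 k : `|c k| <= 1 by rewrite hc.
  have pS : mean_norm S <= m.+1%:R * mean_norm y.
    by apply: rademacher_square_sum => //; rewrite size_iota.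
  have Sy : modulus S <=L N%:R *: y.
    rewrite /S -(size_iota 0 N) -/s; elim: (s) => [|k s' IH].
      by rewrite big_nil modulus0 scale0r.
    rewrite big_cons /= -[(size s').+1%:R]natr1 scalerDl scale1r addrC.
    apply: (rle_trans (modulusD _ _)); apply: rleD => //.
    by rewrite modulusZ hc scale1r r_modulus.
  have nS : `|N%:R^-1 *: S| < d.
    have Ni : 0 <= N%:R^-1 :> R by rewrite invr_ge0 ltW.
    apply: hh.
      rewrite modulusZ (ger0_norm Ni); have := rleZ Ni Sy.
      by rewrite scalerA mulVf ?gt_eqF // scale1r.
    apply: (le_lt_trans (mean_normZ _ _)); rewrite (ger0_norm Ni) mulrC ltr_pdivrMr //.
    apply: (le_lt_trans pS); rewrite /N natrM mulrA [X in X < _]mulrC.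
    by rewrite ltr_pM2r ?ltr0n.
  have -> : \sum_(k <- s) c k *: K (r k) = K S.
    by rewrite linear_sum; apply: eq_bigr => k _; rewrite linearZ.
  apply: (rle_trans (rle_modulus _)); apply: (rle_trans (positive_op_modulus _)).
  apply: (rle_trans (hKu _ (modulus_ge0 _))); rewrite norm_modulus.
  apply: rscale_le => //.
  move: nS; rewrite normrZ (gtr0_norm (_ : 0 < N%:R^-1)) ?invr_gt0 // mulrC.
  by rewrite ltr_pdivrMr // mulrC => /ltW.
have := sum_modulus_le_signs (x := fun k => K (r k)) (iota_uniq 0 N) bound.
under eq_bigr do rewrite image_modulus.
rewrite big_const_seq count_predT size_iota iter_addr_0 => hN.
exists (d *: u).
  have := rleZ (a := N%:R^-1) _ hN; rewrite -[K y *+ N]scaler_nat !scalerA.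
  have NN : N%:R^-1 * N%:R = 1 :> R by rewrite mulVf ?gt_eqF.
  rewrite [N%:R^-1 * (_ * _)]mulrA NN scale1r mul1r; apply.
  by rewrite invr_ge0 ltW.
rewrite normrZ (gtr0_norm d0) /d mulrAC ler_pdivrMr //.
by rewrite ler_pM2l // lerDl.
Qed.

End AgainstRademacher.
End DominatedOperators.
End StrictSeminorm.

(** The theorem for a semigroup in which the rotation has period 2. *)
Lemma no_rotating_pair (hE : order_continuous_norm E)
    (hirr : irreducible_semigroup P) (a b : E) (t0 : R) (K : {linear E -> E}) :
  (forall t, 0 <= t -> P t a = cos (pi * t) *: a - sin (pi * t) *: b) ->
  ~ (a = 0 /\ b = 0) -> 0 <= t0 -> positive_op K -> op_le K (P t0) ->
  ~ (forall x, K x = 0) ->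
  compact_op K \/ (exists2 u, 0 <=L u & forall x, 0 <=L x -> K x <=L `|x| *: u) ->
  False.
Proof.
move=> Pa ab0 t00 K0 KP Kn0 hK.
have a0 : a <> 0 by move=> e; apply: ab0; split => //; exact: rotating_eq0 Pa e.
have [y1 [y1P ay1 _]] := orbit_modulus hE Pa.
have strict : forall x, mean_norm x = 0 -> x = 0.
  apply: (mean_norm_eq0 hirr (y := y1)) => //; last exact: rle_trans (modulus_ge0 a) ay1.
  by move=> y10; apply/a0/modulus_eq0/rle_anti => //; rewrite -y10.
have [y [r [yn0 yP ry rP]]] := rademacher_exist strict hE Pa ab0.
have y0 : 0 <=L y by rewrite -(ry 0%N).
apply: Kn0; apply: (dominated_fixed_eq0 t00 K0 KP hirr yn0 y0 yP).
case: hK => [cK|[u u0 hu]].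
  exact: (compact_dominated_eq0 strict t00 K0 KP yP ry rP).
exact: (norm_dominated_eq0 strict t00 K0 KP hE yP ry rP u0).
Qed.
End PositiveSemigroup.

(** * The orbit of an eigenvector *)

Lemma derive_first_order {R : realType} (f : R -> R) (df : R) : is_derive (0 : R) 1 f df ->
  forall e : R, 0 < e -> exists2 d : R, 0 < d &
    forall x, `|x| < d -> `|f x - f 0 - df * x| <= e * `|x|.
Proof.
move=> [df1 df2] e e0.
have h : (fun h : R => h^-1 *: ((f \o shift 0) (h *: (1 : R)) - f 0)) @ 0^' --> df.
  by rewrite -df2; exact: df1.
have /cvgrPdist_lt/(_ _ e0)[d /= d0 hd] := h.
exists d => // x xd; have [->|x0] := eqVneq x 0; first by rewrite subrr mulr0 subr0 normr0 mulr0.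
have := hd x; rewrite /= sub0r normrN => /(_ xd x0) hx.
have xn : 0 < `|x| by rewrite normr_gt0.
have -> : f x - f 0 - df * x = - (df - x^-1 *: ((f \o shift 0) (x *: (1 : R)) - f 0)) * x.
  have -> : (f \o shift 0) (x *: (1 : R)) = f x by rewrite /= addr0 /GRing.scale /= mulr1.
  by rewrite /GRing.scale /=; field.
by rewrite normrM normrN ler_pM2r // ltW.
Qed.

Section EigenvectorOrbit.
Context {R : realType} {E : banachLatticeType R}.
Variables (T : R -> {linear E -> E}) (M : R).
Hypothesis hT : C0_semigroup T.
Hypothesis M_ge0 : 0 <= M.
Hypothesis T_bounded : forall t : R, 0 <= t -> forall x, `|T t x| <= M * `|x|.
Variables (w : R) (a b : E).
Hypothesis gen_a : generator T a (- w *: b).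
Hypothesis gen_b : generator T b (w *: a).

Let T_add (t s : R) x : 0 <= t -> 0 <= s -> T (t + s) x = T t (T s x).
Proof. by case: hT => _ _ h _ t0 s0; exact: h. Qed.

Lemma generator_first_order x y : generator T x y -> forall e : R, 0 < e ->
  exists2 d : R, 0 < d & forall h, 0 < h -> h < d ->
    exists2 z, T h x = x + h *: y + h *: z & `|z| <= e.
Proof.
move=> /cvgrPdist_lt g e e0; have [d /= d0 hd] := g _ e0.
exists d => // h h0 hh; exists (h^-1 *: (T h x - x) - y); last first.
  rewrite distrC ltW //; apply: hd => //=.
  by rewrite sub0r normrN gtr0_norm.
rewrite scalerBr scalerA mulfV ?gt_eqF // scale1r.
module_identity.
Qed.

(* The components of the curve [exp(- i w t) T(t) (a + i b)]. *)
Let u (t : R) := cos (w * t) *: T t a + sin (w * t) *: T t b.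
Let v (t : R) := cos (w * t) *: T t b - sin (w * t) *: T t a.
Let gap (t : R) := `|u t - a| + `|v t - b|.

Let rotated_norm (t c s : R) x z : 0 <= t -> `|c| <= 1 -> `|s| <= 1 ->
  `|c *: T t x + s *: T t z| <= M * (`|x| + `|z|).
Proof.
move=> t0 c1 s1; apply: (le_trans (ler_normD _ _)); rewrite !normrZ mulrDr.
by apply: lerD; apply: le_trans (T_bounded t0 _); apply: ler_piMl.
Qed.

Let cos_norm (x : R) : `|cos x| <= 1.
Proof. by rewrite ler_norml cos_geN1 cos_le1. Qed.
Let sin_norm (x : R) : `|sin x| <= 1.
Proof. by rewrite ler_norml sin_geN1 sin_le1. Qed.

(* The deviation at [t + h] is the deviation at [t] plus the image of the one at [h]
   under a rotation of [T t]. *)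
Let gapD (t h : R) : 0 <= t -> 0 <= h -> gap (t + h) <= gap t + M * 2 * gap h.
Proof.
move=> t0 h0.
have eu : u (t + h) - a = (u t - a) +
    (cos (w * t) *: T t (u h - a) + sin (w * t) *: T t (v h - b)).
  rewrite /u /v !T_add // mulrDr cosD sinD !(linearB (T t)) /= ?(linearB (T t)) /= !(linearD (T t)) /= !(linearZZ (T t)) /=.
  by module_identity.
have ev : v (t + h) - b = (v t - b) +
    (cos (w * t) *: T t (v h - b) + - sin (w * t) *: T t (u h - a)).
  rewrite /u /v !T_add // mulrDr cosD sinD !(linearB (T t)) /= ?(linearB (T t)) /= !(linearD (T t)) /= !(linearZZ (T t)) /=.
  by module_identity.
have nu : `|u (t + h) - a| <= `|u t - a| + M * gap h.
  by rewrite eu; apply: (le_trans (ler_normD _ _)); rewrite lerD2l rotated_norm.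
have nv : `|v (t + h) - b| <= `|v t - b| + M * gap h.
  rewrite ev; apply: (le_trans (ler_normD _ _)); rewrite lerD2l.
  by rewrite /gap [X in M * X]addrC rotated_norm // normrN.
by rewrite /gap -/(gap h); lra.
Qed.

Let gap_multiple (h : R) (n : nat) : 0 <= h -> gap (n%:R * h) <= n%:R * (M * 2 * gap h).
Proof.
move=> h0; elim: n => [|n IH].
  have T0 x : T 0 x = x by case: hT => _ ->.
  rewrite !mul0r /gap /u /v !mulr0 cos0 sin0 !T0 !scale1r !scale0r addr0 subr0 !subrr.
  by rewrite normr0 addr0.
rewrite -[n.+1%:R]natr1 !mulrDl !mul1r; apply: (le_trans (gapD _ h0)).
  by rewrite mulr_ge0.
by rewrite lerD2r.
Qed.

Let gap_small (e : R) : 0 < e -> exists2 d : R, 0 < d &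
  forall h, 0 < h -> h < d -> gap h <= e * h.
Proof.
move=> e0; pose C := 6 * `|w| * (`|a| + `|b|) + 4.
have C0 : 0 < C by rewrite ltr_wpDl // !mulr_ge0 // addr_ge0.
pose f := Num.min 1 (e / C); have f0 : 0 < f by rewrite lt_min ltr01 divr_gt0.
have f1 : f <= 1 by rewrite ge_min lexx.
have fC : f * C <= e by rewrite -ler_pdivlMr // ge_min lexx orbT.
have [d1 d10 h1] := derive_first_order (is_derive_cos 0) f0.
have [d2 d20 h2] := derive_first_order (is_derive_sin 0) f0.
have [d3 d30 h3] := generator_first_order gen_a f0.
have [d4 d40 h4] := generator_first_order gen_b f0.
pose k := `|w| + 1; have k0 : 0 < k by rewrite ltr_wpDl.
pose d := Num.min (Num.min (d1 / k) (d2 / k)) (Num.min (Num.min d3 d4) (f / k)).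
exists d; first by rewrite !lt_min !divr_gt0 // d30 d40.
move=> h hh; rewrite !lt_min => /andP[/andP[hd1 hd2] /andP[/andP[hd3 hd4] hf]].
have wh g : h < g / k -> `|w * h| < g.
  rewrite ltr_pdivlMr // => hg; apply: le_lt_trans hg.
  by rewrite normrM (gtr0_norm hh) mulrC ler_pM2l // lerDl.
have {h1} := h1 _ (wh _ hd1); have {h2} := h2 _ (wh _ hd2); have {hf} := wh _ hf.
rewrite cos0 sin0 oppr0 mul0r !(subr0, addr0) mul1r.
set x := w * h; set c := cos x; set s := sin x => xf hs hc.
have xE : `|x| = `|w| * h by rewrite normrM (gtr0_norm hh).
have [z1 Ea nz1] := h3 h hh hd3; have [z2 Eb nz2] := h4 h hh hd4.
have x0 := normr_ge0 x.
have s2 : `|s| <= 2 * `|x|.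
  have := ler_normD (s - x) x; rewrite subrK => /le_trans; apply.
  apply: (le_trans (lerD hs (lexx _))).
  by have := ler_wpM2r x0 f1; lra.
have p1 : `|c + x * s - 1| <= 3 * f * `|x|.
  have -> : c + x * s - 1 = (c - 1) + x * s by ring.
  apply: (le_trans (ler_normD _ _)); rewrite normrM.
  have h5 := ler_wpM2l x0 s2; have h6 := ler_wpM2r x0 (ltW xf).
  by move: hc h5 h6; lra.
have p2 : `|s - x * c| <= 3 * f * `|x|.
  have -> : s - x * c = (s - x) - x * (c - 1) by ring.
  apply: (le_trans (ler_normB _ _)); rewrite normrM.
  have h5 := ler_wpM2l x0 hc.
  have h6 := ler_wpM2r x0 (le_trans (ltW xf) f1).
  have h7 := ler_wpM2l (ltW f0) h6.
  have h8 := mulr_ge0 (ltW f0) x0.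
  by move: hs h5 h7 h8; rewrite mul1r; lra.
have est p q B (y z y' z' : E) : `|p| <= B -> `|q| <= B ->
    `|y'| <= f -> `|z'| <= f -> forall c' s' : R, `|c'| <= 1 -> `|s'| <= 1 ->
    `|p *: y + q *: z + h *: (c' *: y' + s' *: z')| <=
    B * (`|y| + `|z|) + h * (f + f).
  move=> hp hq hy hz c' s' hc' hs'; apply: (le_trans (ler_normD _ _)); apply: lerD.
    apply: (le_trans (ler_normD _ _)); rewrite !normrZ mulrDr.
    by apply: lerD; apply: ler_wpM2r.
  rewrite normrZ (gtr0_norm hh); apply: ler_wpM2l; first exact: ltW.
  apply: (le_trans (ler_normD _ _)); rewrite !normrZ; apply: lerD.
    by apply: le_trans hy; apply: ler_piMl.
  by apply: le_trans hz; apply: ler_piMl.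
have eu : u h - a = (c + x * s - 1) *: a + (s - x * c) *: b + h *: (c *: z1 + s *: z2).
  by rewrite /u -/x -/c -/s Ea Eb /x; module_identity.
have ev : v h - b = (c + x * s - 1) *: b + (- (s - x * c)) *: a + h *: (c *: z2 + (- s) *: z1).
  by rewrite /v -/x -/c -/s Ea Eb /x; module_identity.
have nu : `|u h - a| <= 3 * f * `|x| * (`|a| + `|b|) + h * (f + f).
  by rewrite eu; apply: est => //; [exact: cos_norm|exact: sin_norm].
have nv : `|v h - b| <= 3 * f * `|x| * (`|b| + `|a|) + h * (f + f).
  by rewrite ev; apply: est; rewrite ?normrN //; [exact: cos_norm|exact: sin_norm].
apply: le_trans (_ : f * C * h <= _); last by apply: ler_wpM2r => //; exact: ltW.
apply: (le_trans (lerD nu nv)); rewrite xE /C.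
by rewrite le_eqVlt; apply/orP; left; apply/eqP; ring.
Qed.

(** The curve [exp(- i w t) T(t) (a + i b)] moves by [o(h)] in time [h], and by the
semigroup law this holds uniformly along the curve; hence it is constant. *)
Lemma eigenvector_orbit (t : R) : 0 <= t ->
  T t a = cos (w * t) *: a - sin (w * t) *: b /\
  T t b = sin (w * t) *: a + cos (w * t) *: b.
Proof.
move=> t0; have gap0 : gap t = 0.
  have gap_ge0 : 0 <= gap t by rewrite addr_ge0.
  apply/eqP; rewrite eq_le gap_ge0 andbT; apply/ler_addgt0Pr => e e0; rewrite add0r.
  move: t0; rewrite le_eqVlt => /predU1P[<-|t0].
    have := @gap_multiple 0 0 (lexx _); rewrite !mul0r => /le_trans; apply; exact: ltW.
  pose D := M * 2 * t + 1.
  have D0 : 0 < D by rewrite ltr_wpDl // !mulr_ge0 // ltW.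
  have [d d0 hd] := gap_small (divr_gt0 e0 D0).
  pose n := (Num.bound (t / d)).+1; have n0 : 0 < n%:R :> R by rewrite ltr0n.
  have tn : 0 < t / n%:R by rewrite divr_gt0.
  have tnd : t / n%:R < d.
    rewrite ltr_pdivrMr // mulrC -ltr_pdivrMr //; apply: lt_le_trans (archi_boundP _) _.
      by rewrite divr_ge0 // ltW.
    by rewrite ler_nat.
  have := gap_multiple n (ltW tn); rewrite mulrC divfK ?gt_eqF // => /le_trans; apply.
  have M2 : 0 <= M * 2 by rewrite mulr_ge0.
  apply: (le_trans (ler_wpM2l (ltW n0) (ler_wpM2l M2 (hd _ tn tnd)))).
  have -> : n%:R * (M * 2 * (e / D * (t / n%:R))) = e * (M * 2 * t) / D.
    by field; rewrite gt_eqF // gt_eqF.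
  by rewrite ler_pdivrMr // ler_pM2l // lerDl.
have [/eqP ua /eqP vb] : `|u t - a| == 0 /\ `|v t - b| == 0.
  by apply/andP; rewrite -paddr_eq0 //; apply/eqP.
move/eqP: ua; rewrite normr_eq0 subr_eq0 => /eqP ua.
move/eqP: vb; rewrite normr_eq0 subr_eq0 => /eqP vb.
have cs := cos2Dsin2 (w * t).
move: ua vb; rewrite /u /v; set c := cos _ in cs *; set s := sin _ in cs * => ua vb.
have ea : c *: (c *: T t a + s *: T t b) - s *: (c *: T t b - s *: T t a) = c *: a - s *: b.
  by rewrite ua vb.
have eb : s *: (c *: T t a + s *: T t b) + c *: (c *: T t b - s *: T t a) = s *: a + c *: b.
  by rewrite ua vb.
rewrite -ea -eb; split.
  have {1}-> : T t a = (c ^+ 2 + s ^+ 2) *: T t a by rewrite cs scale1r.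
  by module_identity.
have {1}-> : T t b = (c ^+ 2 + s ^+ 2) *: T t b by rewrite cs scale1r.
by module_identity.
Qed.
End EigenvectorOrbit.

Theorem theorem3p1 (R : realType) (E : banachLatticeType R)
    (hE : order_continuous_norm E)
    (T : R -> {linear E -> E})
    (hT : C0_semigroup T)
    (hpos : positive_semigroup T)
    (hirr : irreducible_semigroup T)
    (hbdd : bounded_semigroup T)
    (hK : exists t0 : R, 0 < t0 /\
      exists K : {linear E -> E},
        [/\ op_le K (T t0), positive_op K, ~ (forall x, K x = 0)
          & compact_op K \/ kernel_op K]) :
  point_spectrum (complexify_graph (generator T)) `&` imaginary_axis R
    `<=` [set 0].
Proof.
move=> [l1 l2] [[[a b] /= ab0 [/= ga gb]] /= l10].
move: ga gb; rewrite /imaginary_axis /= in l10; rewrite l10 !scale0r !add0r => ga gb.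
rewrite /=; congr Complex; apply: contrapT => /eqP w0.
have {hbdd}[M0 hM0] := hbdd.
pose M := Num.max M0 0; have M_ge0 : 0 <= M by rewrite le_max lexx orbT.
have hM t : 0 <= t -> forall x, `|T t x| <= M * `|x|.
  move=> t0 x; apply: (le_trans (hM0 _ t0 x)); apply: ler_wpM2r => //.
  by rewrite le_max lexx.
have ab_neq0 : ~ (a = 0 /\ b = 0) by move=> [a0 b0]; apply: ab0; rewrite a0 b0.
have orb := eigenvector_orbit hT M_ge0 hM (w := l2).
rewrite -scaleNr in ga; have {}orb := orb _ _ ga gb.
(* Replacing [b] by [- b] if necessary, the frequency is positive. *)
have [w [b' [wpos hb' rot]]] : exists w b', [/\ 0 < w, ~ (a = 0 /\ b' = 0) &
    forall t, 0 <= t -> T t a = cos (w * t) *: a - sin (w * t) *: b'].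
  case: (ltgtP l2 0) => h; last by rewrite h eqxx in w0.
    exists (- l2), (- b); split; first by rewrite oppr_gt0.
      by move=> [e1 e2]; apply: ab_neq0; split => //; rewrite -[b]opprK e2 oppr0.
    by move=> t /orb[-> _]; rewrite mulNr cosN sinN scalerN scaleNr opprK.
  by exists l2, b; split => // t /orb[].
have [t0 [t0_gt0 [K [KT K0 Kn0 hcK]]]] := hK.
pose k := pi / w; have k0 : 0 < k by rewrite divr_gt0 // pi_gt0.
pose P (t : R) : {linear E -> E} := T (t * k).
have pk t : 0 <= t -> 0 <= t * k by move=> h; rewrite mulr_ge0 // ltW.
have [_ T0 Tadd _] := hT.
have P0 x : P 0 x = x by rewrite /P mul0r T0.
have PD t s : 0 <= t -> 0 <= s -> forall x, P (t + s) x = P t (P s x).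
  by move=> ht hs x; rewrite /P mulrDl Tadd // pk.
have Ppos : positive_semigroup P by move=> t ht; exact/hpos/pk.
have Pbd t : 0 <= t -> forall x, `|P t x| <= M * `|x| by move=> ht; exact/hM/pk.
have Pt t : P (t / k) = T t by rewrite /P divfK // gt_eqF.
have Pirr : irreducible_semigroup P.
  move=> J J1 J2 J3; apply: hirr => // t ht; rewrite -Pt.
  by apply: J3; rewrite divr_ge0 // ltW.
have Pa t : 0 <= t -> P t a = cos (pi * t) *: a - sin (pi * t) *: b'.
  move=> ht; rewrite /P rot ?pk //.
  by have -> : w * (t * k) = pi * t by rewrite /k; field; rewrite gt_eqF.
have t0k : 0 <= t0 / k by rewrite divr_ge0 // ltW.
have no := no_rotating_pair P0 PD Ppos M_ge0 Pbd hE Pirr Pa hb' t0k.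
case: hcK => [cK|kK].
  by apply: (no K) => //; [rewrite Pt|left].
have [Q [Q0 QK Qn0 Qu]] := kernel_op_minorant hE kK K0 Kn0.
apply: (no Q) => //; last by right.
by rewrite Pt => x x0; exact: rle_trans (QK x x0) (KT x x0).
Qed.
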